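(* Suppose $n$ is an odd integer with $t_3\leq n<\min\{t_1,t_2\}$, and put $K=k_1+k_2+k_3$. Then: (i) the $\mathfrak{BI}$-module $\mathscr M_n(x_3)$ is isomorphic to $W_1\oplus W_1$, where $W_1=O_{n-t_3}\big(k_1+\tfrac{n+1}{2},\,-K-\tfrac{n+1}{2},\,-k_2-\tfrac{n+1}{2}\big)^{((-1,-1),(1\,3\,2))}$; (ii) the $\mathfrak{BI}$-module $\mathscr M_n/\mathscr M_n(x_3)$ is isomorphic to $W_2\oplus W_2$, where $W_2=O_{t_3-1}(k_1,\,-K-n-1,\,k_2)^{(1\,3\,2)}$. Moreover, if $k_1,k_2\geq0$, then $W_1,W_2$ are irreducible and isomorphic to $O_{n-t_3}\big(-k_2-\tfrac{n+1}{2},\,-k_1-\tfrac{n+1}{2},\,K+\tfrac{n+1}{2}\big)$ and $O_{t_3-1}(k_2,\,k_1,\,-K-n-1)$, respectively.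
   Context: Fix real numbers $k_1,k_2,k_3$. For $i=1,2,3$ let $R_i$ be the operator on functions on $\mathbb R^3$ replacing $x_i$ by $-x_i$, and $T_if=\frac{\partial f}{\partial x_i}+k_i\frac{f-R_if}{x_i}$ (Dunkl operators). Let $\sigma_1=\begin{pmatrix}0&1\\1&0\end{pmatrix}$, $\sigma_2=\begin{pmatrix}0&-\sqrt{-1}\\ \sqrt{-1}&0\end{pmatrix}$, $\sigma_3=\begin{pmatrix}1&0\\0&-1\end{pmatrix}$, and let $e_i$ act on $\mathbb C^2$ by $\sigma_i$. Tensor products are over $\mathbb R$; $\mathbb R[\cdots]_m$ denotes homogeneous polynomials of degree $m$. Let $\mathbf D=e_1\otimes T_1+e_2\otimes T_2+e_3\otimes T_3$ and $\mathscr M_n=\ker(\mathbf D|_{\mathbb C^2\otimes\mathbb R[x_1,x_2,x_3]_n})$. For $i=1,2,3$ set $t_i=-2k_i$ if $2k_i$ is an odd negative integer, and $t_i=\infty$ otherwise. For $i=1,2,3$, $\mathscr M_n(x_i)=\mathscr M_n\cap\bigoplus_{j=t_i}^n\mathbb C^2\otimes(x_i^j\cdot\mathbb R[x_p,x_q]_{n-j})$ where $\{p,q\}=\{1,2,3\}\setminus\{i\}$ (it is $\{0\}$ if $n<t_i$); it is a $\mathfrak{BI}$-submodule of $\mathscr M_n$. $\mathfrak{BI}$ is the unital associative $\mathbb C$-algebra generated by $X,Y,Z$ with relations saying that $\{X,Y\}-Z$, $\{Y,Z\}-X$, $\{Z,X\}-Y$ commute with $X,Y,Z$ ($\{A,B\}=AB+BA$).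 $\mathscr M_n$ is a $\mathfrak{BI}$-module via $X=(\sqrt{-1}\,e_1\otimes(x_3T_2-x_2T_3)+\tfrac12)R_2R_3+k_2R_3+k_3R_2$, $Y=(\sqrt{-1}\,e_2\otimes(x_1T_3-x_3T_1)+\tfrac12)R_1R_3+k_3R_1+k_1R_3$, $Z=(\sqrt{-1}\,e_3\otimes(x_2T_1-x_1T_2)+\tfrac12)R_1R_2+k_1R_2+k_2R_1$, operators composed right to left, $R_i$ acting on the polynomial factor. Twisting: for a $\mathfrak{BI}$-module $V$ and algebra automorphism $\varepsilon$, $V^\varepsilon$ is $V$ with action $x\cdot v=\varepsilon(x)v$. Write $(W_1,W_2,W_3)=(X,Y,Z)$. A permutation $\sigma\in\mathfrak S_3$ denotes the automorphism $W_i\mapsto W_{\sigma(i)}$; the sign automorphisms are $(1,-1)\colon X\mapsto X,Y\mapsto -Y,Z\mapsto -Z$; $(-1,1)\colon X\mapsto -X,Y\mapsto Y,Z\mapsto -Z$; $(-1,-1)\colon X\mapsto -X,Y\mapsto -Y,Z\mapsto Z$; and a pair $(\epsilon,\sigma)$ denotes the composite automorphism $\epsilon\circ\sigma$. For $a,b,c\in\mathbb C$ and even $d\geq0$, $O_d(a,b,c)$ is the $\mathfrak{BI}$-module $\mathbb C^{d+1}$ in which, w.r.t. a basis $v_0,\dots,v_d$, $X$ acts by the lower bidiagonal matrix with diagonal $(\theta_0,\dots,\theta_d)$ and subdiagonal entries $1$, $Y$ by the upper bidiagonal matrix with diagonal $(\theta^*_0,\dots,\theta^*_d)$ and superdiagonal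 $(\varphi_1,\dots,\varphi_d)$, and $Z=\{X,Y\}-(2ab-c(d+1))$, where $\theta_i=\frac{(-1)^i(2a-d+2i)}{2}$, $\theta^*_i=\frac{(-1)^i(2b-d+2i)}{2}$, $\varphi_i=\frac{i(d+1-2i-2a-2b-2c)}{2}$ ($i$ even), $\varphi_i=\frac{(i-d-1)(d+1-2i-2a-2b+2c)}{2}$ ($i$ odd). *)

(* Defs.v *)
From HB Require Import structures.
From mathcomp Require Import all_boot all_order all_algebra.
From mathcomp Require Import complex.
From mathcomp Require Import mpoly.
Set Implicit Arguments. Unset Strict Implicit. Unset Printing Implicit Defensive.
Import Order.TTheory GRing.Theory Num.Theory.
Local Open Scope ring_scope.

Section Dunkl.
Variable R : rcfType.
Local Notation C := (complex R).

Definition cR (x : R) : C := Complex x 0.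
Definition iC : C := Complex 0 1.

(* complex polynomials in x1,x2,x3 (variables indexed 0,1,2);
   C^2 (x)_R R[x1,x2,x3] is identified with pairs of complex polynomials. *)
Definition Pol := {mpoly C[3]}.

Definition x1 : 'I_3 := @Ordinal 3 0 isT.
Definition x2 : 'I_3 := @Ordinal 3 1 isT.
Definition x3 : 'I_3 := @Ordinal 3 2 isT.

Definition kvec (k1 k2 k3 : R) (i : 'I_3) : R :=
  match nat_of_ord i with 0%N => k1 | 1%N => k2 | _ => k3 end.
Definition V := (Pol * Pol)%type.

(* homogeneous of degree d (the zero polynomial included) *)
Definition homogeneous (d : nat) (p : Pol) : bool :=
  all (fun m : 'X_{1..3} => mdeg m == d) (msupp p).

Definition refl (i : 'I_3) (p : Pol) : Pol :=
  p \mPo [tuple (if j == i then - 'X_j else 'X_j) | j < 3].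

(* division by x_i of a polynomial all of whose monomials contain x_i *)
Definition divX (i : 'I_3) (q : Pol) : Pol :=
  \sum_(m <- msupp q | (0 < m i)%N) q@_m *: 'X_[(m - U_(i))%MM].

Definition dunkl (k : 'I_3 -> R) (i : 'I_3) (p : Pol) : Pol :=
  mderiv i p + cR (k i) *: divX i (p - refl i p).

(* Pauli matrices acting on C^2 (x) polynomials *)
Definition sigma (i : 'I_3) (v : V) : V :=
  match nat_of_ord i with
  | 0%N => (v.2, v.1)
  | 1%N => (- iC *: v.2, iC *: v.1)
  | _ => (v.1, - v.2)
  end.

Definition onV (L : Pol -> Pol) (v : V) : V := (L v.1, L v.2).
Definition addV (v w : V) : V := (v.1 + w.1, v.2 + w.2).
Definition scaleV (a : C) (v : V) : V := (a *: v.1, a *: v.2).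

Definition Dirac (k : 'I_3 -> R) (v : V) : V :=
  addV (sigma x1 (onV (dunkl k x1) v))
       (addV (sigma x2 (onV (dunkl k x2) v)) (sigma x3 (onV (dunkl k x3) v))).

Definition Mn (k : 'I_3 -> R) (n : nat) (v : V) : Prop :=
  [/\ homogeneous n v.1, homogeneous n v.2 & Dirac k v = (0, 0)].

(* M_n(x_3) for a finite value t = t_3 : only monomials x_3^j (...) with j >= t *)
Definition Mn_x3 (k : 'I_3 -> R) (n t : nat) (v : V) : Prop :=
  Mn k n v /\
  (forall m : 'X_{1..3}, m \in msupp v.1 -> (t <= m x3)%N) /\
  (forall m : 'X_{1..3}, m \in msupp v.2 -> (t <= m x3)%N).

Definition ang (k : 'I_3 -> R) (a b : 'I_3) (p : Pol) : Pol :=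
  'X_a * dunkl k b p - 'X_b * dunkl k a p.

Definition BIop (k : 'I_3 -> R) (i p q : 'I_3) (L : Pol -> Pol) (v : V) : V :=
  let w := onV (fun f => refl p (refl q f)) v in
  addV (addV (scaleV iC (sigma i (onV L w))) (scaleV (cR (1/2)) w))
       (addV (scaleV (cR (k q)) (onV (refl p) v)) (scaleV (cR (k p)) (onV (refl q) v))).

Definition opX (k : 'I_3 -> R) : V -> V := BIop k x1 x2 x3 (ang k x3 x2).
Definition opY (k : 'I_3 -> R) : V -> V := BIop k x2 x1 x3 (ang k x1 x3).
Definition opZ (k : 'I_3 -> R) : V -> V := BIop k x3 x1 x2 (ang k x2 x1).

(* The module O_d(a,b,c) on C^{d+1} (column vectors, basis v_0..v_d) *)
Definition Otheta (a : C) (d i : nat) : C :=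
  (-1) ^+ i * (2 * a - d%:R + 2 * i%:R) / 2.
Definition Ophi (a b c : C) (d i : nat) : C :=
  if ~~ odd i then i%:R * (d%:R + 1 - 2 * i%:R - 2 * a - 2 * b - 2 * c) / 2
  else (i%:R - d%:R - 1) * (d%:R + 1 - 2 * i%:R - 2 * a - 2 * b + 2 * c) / 2.

Definition OX (d : nat) (a b c : C) : 'M[C]_(d.+1) :=
  \matrix_(i, j) (if i == j :> nat then Otheta a d j
                  else if i == j.+1 :> nat then 1 else 0).
Definition OY (d : nat) (a b c : C) : 'M[C]_(d.+1) :=
  \matrix_(i, j) (if i == j :> nat then Otheta b d i
                  else if j == i.+1 :> nat then Ophi a b c d j else 0).
Definition OZ (d : nat) (a b c : C) : 'M[C]_(d.+1) :=
  OX d a b c *m OY d a b c + OY d a b c *m OX d a b c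
  - (2 * a * b - c * d.+1%:R)%:M.

(* a BI-module structure on C^{d+1}: the three matrices by which X, Y, Z act *)
Definition mat3 (d : nat) := ('M[C]_(d.+1) * 'M[C]_(d.+1) * 'M[C]_(d.+1))%type.
Definition Omod (d : nat) (a b c : C) : mat3 d := (OX d a b c, OY d a b c, OZ d a b c).

(* twists: V^eps has X acting by eps(X) etc. *)
(* (1 3 2) : X |-> Z, Y |-> X, Z |-> Y *)
Definition twist132 d (M : mat3 d) : mat3 d := (M.2, M.1.1, M.1.2).
(* ((-1,-1),(1 3 2)) : X |-> Z, Y |-> -X, Z |-> -Y *)
Definition twistmm132 d (M : mat3 d) : mat3 d := (M.2, - M.1.1, - M.1.2).

Definition actX d (M : mat3 d) := M.1.1.
Definition actY d (M : mat3 d) := M.1.2.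
Definition actZ d (M : mat3 d) := M.2.

Definition mat_iso d (M N : mat3 d) : Prop :=
  exists P : 'M[C]_(d.+1), P \in unitmx /\
    [/\ P *m actX M = actX N *m P, P *m actY M = actY N *m P
      & P *m actZ M = actZ N *m P].

Definition mat_irreducible d (M : mat3 d) : Prop :=
  forall S : 'cV[C]_(d.+1) -> Prop,
    S 0 -> (forall u w, S u -> S w -> S (u + w)) ->
    (forall (a : C) u, S u -> S (a *: u)) ->
    (forall u, S u -> S (actX M *m u) /\ S (actY M *m u) /\ S (actZ M *m u)) ->
    (forall u, S u -> u = 0) \/ (forall u, S u).

Definition dsum_act d (A : 'M[C]_(d.+1)) (w : 'cV[C]_(d.+1) * 'cV[C]_(d.+1)) :=
  (A *m w.1, A *m w.2).

(* phi is C-linear on the subspace S of V (S is assumed to be a subspace) *)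
Definition linear_on (S : V -> Prop) d (phi : V -> 'cV[C]_(d.+1) * 'cV[C]_(d.+1)) :=
  forall (a : C) u w, S u -> S w ->
    phi (addV (scaleV a u) w) = ((a *: (phi u).1 + (phi w).1), (a *: (phi u).2 + (phi w).2)).

Definition intertwines_on (k : 'I_3 -> R) (S : V -> Prop) d (M : mat3 d)
    (phi : V -> 'cV[C]_(d.+1) * 'cV[C]_(d.+1)) :=
  forall u, S u ->
    [/\ phi (opX k u) = dsum_act (actX M) (phi u),
        phi (opY k u) = dsum_act (actY M) (phi u)
      & phi (opZ k u) = dsum_act (actZ M) (phi u)].

Definition iso_to_double (k : 'I_3 -> R) (S : V -> Prop) d (M : mat3 d) : Prop :=
  exists phi : V -> 'cV[C]_(d.+1) * 'cV[C]_(d.+1),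
    [/\ linear_on S phi, intertwines_on k S M phi,
        (forall u w, S u -> S w -> phi u = phi w -> u = w)
      & (forall y, exists2 u, S u & phi u = y)].

(* the quotient S / T (T a BI-submodule of S) is isomorphic to M (+) M:
   a surjective BI-module map from S onto M (+) M whose kernel is T *)
Definition quot_iso_to_double (k : 'I_3 -> R) (S T : V -> Prop) d (M : mat3 d) : Prop :=
  exists phi : V -> 'cV[C]_(d.+1) * 'cV[C]_(d.+1),
    [/\ linear_on S phi, intertwines_on k S M phi,
        (forall u, S u -> (phi u = (0, 0) <-> T u))
      & (forall y, exists2 u, S u & phi u = y)].

End Dunkl.

(* Main.v *)
(* Restrict a spinor v in M_n to the plane x_1 = 0 and read off the coefficients
   of x_2^(n-q) x_3^q.  Write T_i x_i^j = [j]_i x_i^(j-1).  The equation D v = 0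
   expresses the coefficient of x_1^(a+1) through those of x_1^a, with the factor
   [a+1]_1 that is nonzero because n < t_1; hence v is determined by this
   restriction and the restriction is arbitrary.  On monomials Y becomes lower bidiagonal and Z upper bidiagonal
   in q, and the two parities of (spinor component) + q give two identical copies.
   Multiplication by x_3^t_3 is not undone by T_3 as [t_3]_3 = 0, so q >= t_3 is
   the submodule M_n(x_3) and q < t_3 the quotient.

   Irreducibility: X + Z and X - Z anticommute with Y - 1/2 and Y + 1/2 up to
   scalars, so they carry eigenvectors of Y to eigenvectors, down to v_0, which is
   cyclic.  The last two isomorphisms: from a left eigenvector of Y one builds a
   Verma-type sequence of row vectors, and these are the rows of an intertwiner to
   O_d(a,b,c), bijective by irreducibility. *)
From Stdlib Require Import Classical.
Require Import Defs.
From HB Require Import structures.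
From mathcomp Require Import all_boot all_order all_algebra.
From mathcomp Require Import complex ring lra zify.
From mathcomp Require Import mpoly.
Set Implicit Arguments. Unset Strict Implicit. Unset Printing Implicit Defensive.
Import Order.TTheory GRing.Theory Num.Theory.
Local Open Scope ring_scope.

(** * Verma-type sequences of row vectors *)

Section Verma.
Variable R : rcfType.
Local Notation C := (complex R).

(* The numbers theta_(d-m) and phi_(d-m+1) for even d, as formulas valid for every
   m: phi vanishes at m = 0 and m = d + 1, so that the recursions below have no
   boundary cases. *)
Definition revtheta (x : C) (d m : nat) : C :=
  (-1) ^+ m * (2 * x + d%:R - 2 * m%:R) / 2.
Definition revphi (a b c : C) (d m : nat) : C :=
  if odd m then (d%:R + 1 - m%:R) * (2 * m%:R - d%:R - 1 - 2 * a - 2 * b - 2 * c) / 2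
  else - m%:R * (2 * m%:R - d%:R - 1 - 2 * a - 2 * b + 2 * c) / 2.

Variables (d : nat) (a b c : C).
Local Notation th := (revtheta a d).
Local Notation ths := (revtheta b d).
Local Notation ph := (revphi a b c d).
Local Notation kap := (2 * a * b - c * d.+1%:R).
Local Notation lam := (2 * b * c - a * d.+1%:R).
Local Notation mu := (2 * c * a - b * d.+1%:R).

Definition revzeta m : C := 2 * th m * ths m + ph m + ph m.+1 - kap.

Lemma signP m : {(-1) ^+ m = 1 :> C /\ odd m = false} + {(-1) ^+ m = -1 :> C /\ odd m = true}.
Proof. by rewrite -signr_odd; case: (odd m); [right|left]. Qed.

Variables (N : nat) (X Y Z : 'M[C]_N) (z : nat -> 'rV[C]_N).
Hypothesis hX : forall m, z m *m X = th m *: z m + z m.+1.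
Hypothesis hY : forall m, z m *m Y = ths m *: z m + ph m *: z m.-1.
Hypothesis hZ : Z = X *m Y + Y *m X - kap%:M.

(** Since [th m + th m.+1 = (-1) ^+ m], and likewise for [ths], the off-diagonal coefficients of
    [X Y + Y X] are those of [X] and [Y] up to sign; [revzeta] is the diagonal one. *)
Lemma verma_Z m : z m *m Z = revzeta m *: z m + (-1) ^+ m *: z m.+1 - ((-1) ^+ m * ph m) *: z m.-1.
Proof.
rewrite hZ mulmxBr mulmxDr !mulmxA hX hY !mulmxDl -!scalemxAl !hX !hY mul_mx_scalar.
apply/rowP => j; rewrite !mxE /revzeta /revtheta.
case: m => [|m] /=; rewrite ?exprS ?expr0 /revphi /=; [by field|].
by case: (signP m) => -[-> ->] /=; field.
Qed.

(** With [Z] tridiagonal, this and the next two lemmas compare coefficients of at most five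
    consecutive [z]. The cases [m = 0] and [m = 1] are split off because predecessors are truncated
    there. *)
Lemma verma_YZ m : z m *m (Y *m Z + Z *m Y) = z m *m (X + lam%:M).
Proof.
rewrite !mulmxDr !mulmxA hX hY verma_Z mulmxBl !mulmxDl -!scalemxAl !hY !verma_Z mul_mx_scalar.
apply/rowP => j; rewrite !mxE /revzeta /revtheta.
case: m => [|[|m]] /=; rewrite ?exprS ?expr0 /revphi /=; [by field|by field|].
by case: (signP m) => -[-> ->] /=; field.
Qed.

Lemma verma_ZX m : z m *m (Z *m X + X *m Z) = z m *m (Y + mu%:M).
Proof.
rewrite !mulmxDr !mulmxA hX hY verma_Z mulmxBl !mulmxDl -!scalemxAl !hX !verma_Z mul_mx_scalar.
apply/rowP => j; rewrite !mxE /revzeta /revtheta.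
case: m => [|[|m]] /=; rewrite ?exprS ?expr0 /revphi /=; [by field|by field|].
by case: (signP m) => -[-> ->] /=; field.
Qed.

Lemma verma_casimir m : z m *m (X *m X + Y *m Y + Z *m Z) =
  (a ^+ 2 + b ^+ 2 + c ^+ 2 + (d.+1%:R ^+ 2 - 1) / 4) *: z m.
Proof.
rewrite !mulmxDr !mulmxA hX hY verma_Z mulmxBl !mulmxDl -!scalemxAl !hX !hY !verma_Z.
apply/rowP => j; rewrite !mxE /revzeta /revtheta.
case: m => [|[|m]] /=; rewrite ?exprS ?expr0 /revphi /=; [by field|by field|].
by case: (signP m) => -[-> ->] /=; field.
Qed.
End Verma.

(** * The Bannai-Ito relations and the Casimir value of [O_d(a,b,c)] *)

Section Rows.
Variable R : rcfType.
Local Notation C := (complex R).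
Variables (d : nat) (a b c : C).

(** Unit rows in reverse order, extended by zero: for even [d] they form a Verma-type sequence for
    [OX] and [OY], so matrix identities can be checked on them. *)
Definition revrow m : 'rV[C]_d.+1 := if (m <= d)%N then delta_mx 0 (inord (d - m)) else 0.

Lemma revrowE m (j : 'I_d.+1) : revrow m 0 j = ((m + j)%N == d)%:R.
Proof.
rewrite /revrow; case: leqP => hm; last first.
  by rewrite mxE; case: eqP => // h; move: hm; rewrite -h ltnNge leq_addr.
rewrite mxE eqxx /= -val_eqE /= inordK; last by lia.
by congr (nat_of_bool _)%:R; apply/eqP/eqP; lia.
Qed.

Lemma revrow_mul m (M : 'M[C]_d.+1) : (m <= d)%N -> revrow m *m M = row (inord (d - m)) M.
Proof. by move=> h; rewrite rowE /revrow h. Qed.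

Lemma revrow_ext (n : nat) (A B : 'M[C]_(d.+1, n)) :
  (forall m, revrow m *m A = revrow m *m B) -> A = B.
Proof.
move=> h; apply/row_matrixP => i; rewrite !rowE.
have := h (d - i)%N; rewrite /revrow leq_subr.
have -> : inord (d - (d - i)) = i :> 'I_d.+1.
  by apply/val_inj; rewrite /= inordK; have := ltn_ord i; lia.
by [].
Qed.

Hypothesis ed : ~~ odd d.

Lemma Otheta_rev (x : C) m : (m <= d)%N -> Otheta x d (d - m) = revtheta x d m.
Proof.
move=> h; rewrite /Otheta /revtheta natrB // -signr_odd oddB // (negbTE ed) /= signr_odd.
by congr (_ * _ / _); ring.
Qed.

Lemma Ophi_rev m : (0 < m <= d)%N -> Ophi a b c d (d - m).+1 = revphi a b c d m.
Proof.
move=> /andP[h0 h]; have -> : (d - m).+1 = (d - m.-1)%N by lia.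
rewrite /Ophi /revphi oddB ?(negbTE ed) /=; last by lia.
case: m h h0 => // m h _ /=; rewrite natrB ?(ltnW h) //.
by case: (odd m) => /=; rewrite -natr1; field.
Qed.

Lemma revrow_X m : revrow m *m OX d a b c = revtheta a d m *: revrow m + revrow m.+1.
Proof.
case: (leqP m d) => hm; last first.
  apply/rowP => j; rewrite mxE [RHS]mxE mxE !revrowE.
  have -> : ((m + j)%N == d) = false by lia.
  have -> : ((m.+1 + j)%N == d) = false by lia.
  rewrite mulr0n mulr0 addr0 big1 // => i _; rewrite revrowE.
  by rewrite (_ : ((m + i)%N == d) = false) ?mulr0n ?mul0r ?mulr0 //; lia.
rewrite revrow_mul //; apply/rowP => j; rewrite !mxE !revrowE inordK; last by lia.
have hj := ltn_ord j.
case: eqP => h1.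
  have -> : ((m + j)%N == d) = true by lia.
  have -> : ((m.+1 + j)%N == d) = false by lia.
  by rewrite -h1 Otheta_rev // mulr1n mulr0n mulr1 addr0.
have -> : ((m + j)%N == d) = false by lia.
rewrite mulr0n mulr0 add0r; case: eqP => h2.
  by have -> : ((m.+1 + j)%N == d) = true by lia.
by have -> : ((m.+1 + j)%N == d) = false by lia.
Qed.

Lemma revrow_Y m : revrow m *m OY d a b c = revtheta b d m *: revrow m + revphi a b c d m *: revrow m.-1.
Proof.
case: (leqP m d) => hm; last first.
  apply/rowP => j; rewrite mxE [RHS]mxE mxE [X in _ = _ + X]mxE !revrowE.
  have -> : ((m + j)%N == d) = false by lia.
  rewrite mulr0n mulr0 add0r big1 => [|i _]; last first.
    by rewrite revrowE (_ : ((m + i)%N == d) = false) ?mulr0n ?mul0r //; lia.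
  (* Beyond [d] the predecessor is nonzero only for [m = d + 1], and there [revphi] vanishes because
     [d] is even. *)
  case: (eqVneq m d.+1) => [->|h] /=.
    by rewrite /revphi /= ed natr1 subrr !mul0r.
  have -> : ((m.-1 + j)%N == d) = false by lia.
  by rewrite mulr0n mulr0.
rewrite revrow_mul //; apply/rowP => j; rewrite !mxE !revrowE inordK; last by lia.
have hj := ltn_ord j.
case: m hm => [|m] hm /=.
  rewrite /revphi /= oppr0 !mul0r addr0 -(Otheta_rev b (leq0n d)) subn0 add0n (eq_sym d).
  case: eqP => [_ | _]; first by rewrite mulr1.
  by rewrite mulr0n mulr0; case: eqP => //; lia.
rewrite -Ophi_rev // -Otheta_rev //.
case: eqP => h1.
  have -> : ((m.+1 + j)%N == d) = true by lia.
  have -> : ((m + j)%N == d) = false by lia.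
  by rewrite mulr1n mulr0n mulr1 mulr0 addr0.
have -> : ((m.+1 + j)%N == d) = false by lia.
rewrite mulr0n mulr0 add0r; case: eqP => h2.
  have -> : ((m + j)%N == d) = true by lia.
  by rewrite mulr1n mulr1 h2 -?Ophi_rev; congr (Ophi _ _ _ _ _); lia.
by rewrite (_ : ((m + j)%N == d) = false) ?mulr0n ?mul0r ?mulr0 //; lia.
Qed.

Lemma OZ_def : OZ d a b c = OX d a b c *m OY d a b c + OY d a b c *m OX d a b c
  - (2 * a * b - c * d.+1%:R)%:M.
Proof. by []. Qed.

Lemma O_YZ : OY d a b c *m OZ d a b c + OZ d a b c *m OY d a b c =
  OX d a b c + (2 * b * c - a * d.+1%:R)%:M.
Proof. by apply: revrow_ext => m; apply: (verma_YZ revrow_X revrow_Y OZ_def). Qed.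

Lemma O_ZX : OZ d a b c *m OX d a b c + OX d a b c *m OZ d a b c =
  OY d a b c + (2 * c * a - b * d.+1%:R)%:M.
Proof. by apply: revrow_ext => m; apply: (verma_ZX revrow_X revrow_Y OZ_def). Qed.

(** [X^2 + Y^2 + Z^2] is the Casimir element; its value enters the norm of the ladder operators. *)
Lemma O_casimir :
  OX d a b c *m OX d a b c + OY d a b c *m OY d a b c + OZ d a b c *m OZ d a b c =
  (a ^+ 2 + b ^+ 2 + c ^+ 2 + (d.+1%:R ^+ 2 - 1) / 4)%:M.
Proof.
apply: revrow_ext => m; rewrite (verma_casimir revrow_X revrow_Y OZ_def).
by rewrite mul_mx_scalar.
Qed.
End Rows.

(** * Recognising [O_d(a,b,c)] from a left eigenvector of [Y] *)

Section VermaIso.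
Variable R : rcfType.
Local Notation C := (complex R).
Variables (d : nat) (a b c : C).
Hypothesis ed : ~~ odd d.
Variables (X Y Z : 'M[C]_d.+1).
Hypothesis hXY : X *m Y + Y *m X = Z + (2 * a * b - c * d.+1%:R)%:M.
Hypothesis hYZ : Y *m Z + Z *m Y = X + (2 * b * c - a * d.+1%:R)%:M.
Hypothesis hZX : Z *m X + X *m Z = Y + (2 * c * a - b * d.+1%:R)%:M.
Variable e : 'rV[C]_d.+1.
Local Notation t := (b + d%:R / 2).
Hypothesis heY : e *m Y = t *: e.
Hypothesis hu : Y + (t + 1)%:M \in unitmx.

Fixpoint verma_row m : 'rV[C]_d.+1 :=
  if m is m'.+1 then verma_row m' *m X - revtheta a d m' *: verma_row m' else e.

Lemma verma_row_X m : verma_row m *m X = revtheta a d m *: verma_row m + verma_row m.+1.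
Proof. by rewrite /= addrC subrK. Qed.

Lemma Z_anticomm : Z = X *m Y + Y *m X - (2 * a * b - c * d.+1%:R)%:M.
Proof. by rewrite hXY addrK. Qed.

(* [e (X - Z) (Y + t + 1)] is a multiple of [e], hence so is [e (X - Z)]. *)
Lemma verma_row_Z0 : e != 0 -> e *m Z = verma_row 1 + revzeta d a b c 0 *: e.
Proof.
move=> e0.
have h2 : 2 * t + 1 != 0.
  apply/eqP => h; move/eqP: e0; apply.
  rewrite -[e](mulmxK hu) mulmxDr heY mul_mx_scalar -scalerDl.
  by have -> : t + (t + 1) = 2 * t + 1; [ring | rewrite h scale0r mul0mx].
set k := (2 * a * b - c * d.+1%:R - (2 * b * c - a * d.+1%:R)) / (2 * t + 1).
have hk : e *m (X - Z) = k *: e.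
  apply: (can_inj (mulmxK hu)).
  have -> : k *: e *m (Y + (t + 1)%:M) = (k * (2 * t + 1)) *: e.
    by rewrite -scalemxAl mulmxDr heY mul_mx_scalar -scalerDl scalerA; congr (_ *: _); ring.
  rewrite divfK // mulmxBr mulmxBl !mulmxDr !mul_mx_scalar -!mulmxA.
  have -> : X *m Y = Z + (2 * a * b - c * d.+1%:R)%:M - Y *m X by rewrite -hXY addrK.
  have -> : Z *m Y = X + (2 * b * c - a * d.+1%:R)%:M - Y *m Z.
    by rewrite -hYZ [_ *m _ + _]addrC addrK.
  rewrite !mulmxBr !mulmxDr !mul_mx_scalar !mulmxA heY -!scalemxAl.
  by apply/rowP => j; rewrite !mxE; ring.
have -> : e *m Z = e *m X - k *: e by rewrite -hk mulmxBr opprB addrC subrK.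
rewrite /=; apply/rowP => j; rewrite !mxE /k /revzeta /revtheta /revphi /= expr0.
have h2' : 2 * b + d%:R + 1 != 0.
  by have -> : 2 * b + d%:R + 1 = 2 * t + 1; [field | exact: h2].
by field; rewrite [b * 2]mulrC.
Qed.

(** A joint induction: the relation [hXY] turns the formula for [Z] on [z m] into the one for [Y] on
    [z m.+1], and [hZX] then gives [Z] on [z m.+1]. It starts from [verma_row_Z0]. *)
Lemma verma_row_YZ m : e != 0 ->
  verma_row m *m Y = revtheta b d m *: verma_row m + revphi a b c d m *: verma_row m.-1 /\
  verma_row m *m Z = revzeta d a b c m *: verma_row m + (-1) ^+ m *: verma_row m.+1
              - ((-1) ^+ m * revphi a b c d m) *: verma_row m.-1.
Proof.
move=> e0; move: verma_row_X (verma_row_Z0 e0) (erefl e : verma_row 0 = e).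
move: verma_row => z zX zZ0 z0.
have zS n : z n.+1 = z n *m X - revtheta a d n *: z n by rewrite zX addrC addKr.
elim: m => [|m [IHY IHZ]].
  rewrite z0 zZ0 heY /revphi /= expr0 /revtheta expr0 !oppr0 !mul0r mulr0 !scale0r addr0 subr0 scale1r.
  by split; [congr (_ *: _); field | rewrite addrC].
have eY : z m.+1 *m Y = revtheta b d m.+1 *: z m.+1 + revphi a b c d m.+1 *: z m.
  rewrite [in LHS]zS mulmxBl -scalemxAl -mulmxA.
  have -> : X *m Y = Z + (2 * a * b - c * d.+1%:R)%:M - Y *m X by rewrite -hXY addrK.
  rewrite mulmxBr mulmxDr mulmxA IHZ IHY mul_mx_scalar mulmxDl -!scalemxAl !zX.
  apply/rowP => j; rewrite !mxE /revzeta /revtheta.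
  case: m {IHY IHZ} => [|m] /=; rewrite ?exprS ?expr0 /revphi /=; first by field.
  by case: (signP R m) => -[-> ->] /=; field.
split=> //.
rewrite [in LHS]zS mulmxBl -scalemxAl -mulmxA.
have -> : X *m Z = Y + (2 * c * a - b * d.+1%:R)%:M - Z *m X.
  by rewrite -hZX [_ *m _ + _]addrC addrK.
rewrite mulmxBr mulmxDr mulmxA IHZ IHY mul_mx_scalar !(mulmxDl, mulNmx) -!scalemxAl !zX.
apply/rowP => j; rewrite !mxE /revzeta /revtheta.
case: m {IHY IHZ eY} => [|m] /=; rewrite ?exprS ?expr0 /revphi /=; first by field.
by case: (signP R m) => -[-> ->] /=; field.
Qed.

(** Once the sequence stops, the rows [verma_row (d - i)] form an intertwiner. Its right kernel is a
    submodule, and it is not everything because the last row is [e]. *)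
Lemma mat_iso_Omod : mat_irreducible (X, Y, Z) -> e != 0 -> verma_row d.+1 = 0 ->
  mat_iso (X, Y, Z) (Omod d a b c).
Proof.
move=> irr e0 end0.
have zhi m : (d < m)%N -> verma_row m = 0.
  elim: m => // m IH; rewrite ltnS leq_eqVlt => /orP[/eqP <- //|/IH h].
  by rewrite /= h scaler0 mul0mx subr0.
pose P : 'M[C]_d.+1 := \matrix_(i < d.+1) verma_row (d - i).
(* Valid for every [m], both sides being zero beyond [d]. *)
have erP m : revrow R d m *m P = verma_row m.
  case: (leqP m d) => h; last by rewrite zhi // /revrow leqNgt h mul0mx.
  by rewrite revrow_mul // rowK inordK ?subKn //; lia.
have PX : P *m X = OX d a b c *m P.
  by apply: revrow_ext => m; rewrite !mulmxA erP revrow_X // verma_row_X mulmxDl -scalemxAl !erP.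
have PY : P *m Y = OY d a b c *m P.
  apply: revrow_ext => m; rewrite !mulmxA erP revrow_Y // mulmxDl -!scalemxAl !erP.
  by have [] := verma_row_YZ m e0.
have PZ : P *m Z = OZ d a b c *m P.
  rewrite OZ_def Z_anticomm mulmxBr mulmxDr mulmxBl mulmxDl !mulmxA PX PY -!mulmxA PX PY.
  by rewrite mul_mx_scalar mul_scalar_mx.
exists P; split=> //.
have kerP (M L : 'M[C]_d.+1) u : P *m M = L *m P -> P *m u = 0 -> P *m (M *m u) = 0.
  by rewrite mulmxA => -> Pu; rewrite -mulmxA Pu mulmx0.
have [||k u Pu|u Pu|h|h] := irr (fun u => P *m u = 0).
- exact: mulmx0.
- by move=> u w Pu Pw; rewrite mulmxDr Pu Pw addr0.
- by rewrite -scalemxAr Pu scaler0.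
- by split; [exact: kerP PX Pu | split; [exact: kerP PY Pu | exact: kerP PZ Pu]].
(* [kermx] is a left kernel, so the right kernel is reached through the transpose. *)
- rewrite -unitmx_tr -row_free_unit -kermx_eq0; apply/eqP/row_matrixP => i; rewrite row0.
  apply: trmx_inj; rewrite trmx0; apply: h.
  by rewrite -[X in X *m _]trmxK -trmx_mul -row_mul mulmx_ker row0 trmx0.
have P0 : P = 0 by apply/trmx_inj/row_matrixP => j; rewrite -tr_col colE h !trmx0 row0.
by case/eqP: e0; rewrite -[e]/(verma_row 0) -(erP 0%N) P0 mulmx0.
Qed.
End VermaIso.

(** * Irreducibility *)

Section Irreducible.
Variable R : rcfType.
Local Notation C := (complex R).

Lemma cRE : @cR R = real_complex R.
Proof. by []. Qed.

Lemma cR_inj : injective (@cR R).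
Proof. by move=> x y []. Qed.

(* [T] anticommutes with [A] up to a scalar, so [A] maps the [s]-eigenspace of
   [T] to the [-s]-eigenspace up to a multiple of the identity. *)
Lemma ladder N (A T : 'M[C]_N) (k M s : C) (u : 'cV[C]_N) :
  T *m A + A *m T = k%:M -> A *m A + T *m T = M%:M ->
  T *m u = s *: u -> u != 0 -> s != 0 -> M - s ^+ 2 - (k / (2 * s)) ^+ 2 != 0 ->
  let u' := A *m u - (k / (2 * s)) *: u in T *m u' = - s *: u' /\ u' != 0.
Proof.
move=> hTA hAA hu u0 s0 hM u'.
have eTA : T *m (A *m u) = k *: u - s *: (A *m u).
  have : (T *m A + A *m T) *m u = k *: u by rewrite hTA mul_scalar_mx.
  by rewrite mulmxDl -!mulmxA hu -scalemxAr => <-; rewrite addrK.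
have eAA : A *m (A *m u) = (M - s ^+ 2) *: u.
  have : (A *m A + T *m T) *m u = M *: u by rewrite hAA mul_scalar_mx.
  rewrite mulmxDl -!mulmxA hu -scalemxAr hu scalerA scalerBl => <-.
  by rewrite expr2 addrK.
split.
  rewrite /u' mulmxBr eTA -scalemxAr hu; apply/colP => j; rewrite !mxE.
  by field; rewrite s0.
apply/eqP => h; move/eqP: u0; apply.
have : A *m u' + (k / (2 * s)) *: u' = (M - s ^+ 2 - (k / (2 * s)) ^+ 2) *: u.
  rewrite /u' mulmxBr eAA -scalemxAr; apply/colP => j; rewrite !mxE; ring.
rewrite h mulmx0 scaler0 addr0 => /esym/eqP.
by rewrite scaler_eq0 (negbTE hM) /= => /eqP.
Qed.

Variable d : nat.
Section Triangular.
Variables (a b c : C).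

Lemma OY_top (u : 'cV[C]_d.+1) (m : nat) (i : 'I_d.+1) :
  (forall j : 'I_d.+1, (m < j)%N -> u j 0 = 0) -> (m <= i)%N ->
  (OY d a b c *m u) i 0 = Otheta b d i * u i 0.
Proof.
move=> hu hi; rewrite mxE (bigD1 i) //= mxE eqxx big1 ?addr0 // => j ji.
rewrite mxE; case: eqP => [h|_]; first by case/eqP: ji; apply/val_inj.
case: eqP => [h|_]; last by rewrite mul0r.
by rewrite hu ?mulr0 // h ltnS.
Qed.

Variable S : 'cV[C]_d.+1 -> Prop.
Hypothesis S0 : S 0.
Hypothesis SD : forall u w, S u -> S w -> S (u + w).
Hypothesis SZ : forall (k : C) u, S u -> S (k *: u).
Hypothesis SX : forall u, S u -> S (OX d a b c *m u).
Hypothesis SY : forall u, S u -> S (OY d a b c *m u).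

Lemma invariantB u w : S u -> S w -> S (u - w).
Proof. by move=> hu hw; rewrite -scaleN1r; apply: SD => //; apply: SZ. Qed.

(** Induction on the support: either [u] is an eigenvector of the triangular [Y] for its top
    diagonal entry, or subtracting that multiple of [u] from [Y u] leaves a nonzero vector with
    shorter support. *)
Lemma invariant_eigenvector m (u : 'cV[C]_d.+1) : S u -> u != 0 ->
  (forall j : 'I_d.+1, (m <= j)%N -> u j 0 = 0) ->
  exists j w, [/\ (j <= d)%N, S w, w != 0 & OY d a b c *m w = Otheta b d j *: w].
Proof.
elim: m u => [|m IH] u Su u0 hu.
  by case/eqP: u0; apply/colP => j; rewrite hu // mxE.
case: (ltnP d m) => hm.
  apply: (IH u) => // j hj; have := ltn_ord j; lia.
have [h|h] := eqVneq (OY d a b c *m u - Otheta b d m *: u) 0.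
  by exists m, u; split=> //; apply/eqP; rewrite -subr_eq0 h.
apply: (IH _ _ h) => [|j hj]; first by apply: invariantB; [apply: SY | apply: SZ].
rewrite [LHS]mxE (OY_top hu hj) [X in _ + X]mxE [X in _ - X]mxE.
move: hj; rewrite leq_eqVlt => /orP[/eqP ->|hj]; first by rewrite subrr.
by rewrite hu // !mulr0 subrr.
Qed.

(** The first diagonal entry of the triangular [Y] occurs only once, so [w] is a multiple of [v_0];
    the unit subdiagonal of [X] then produces every [v_m]. *)
Lemma invariant_full w : (forall j, (0 < j <= d)%N -> Otheta b d j != Otheta b d 0) ->
  S w -> w != 0 -> OY d a b c *m w = Otheta b d 0 *: w -> forall u, S u.
Proof.
move=> hth Sw w0 hw.
(* Coordinates are cleared from the top index downwards. *)
have w_top m : (m <= d)%N -> forall j : 'I_d.+1, (d - m < j)%N -> w j 0 = 0.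
  elim: m => [|m IH] hm j hj; first by have := ltn_ord j; lia.
  have [/IH h|h] := ltnP (d - m) j; first by apply: h; lia.
  have /eqP : (OY d a b c *m w) j 0 = Otheta b d 0 * w j 0 by rewrite hw mxE.
  rewrite (OY_top (IH (ltnW hm))); last by lia.
  rewrite -subr_eq0 -mulrBl mulf_eq0 subr_eq0 (negbTE (hth j _)); last first.
    by have := ltn_ord j; lia.
  by move=> /eqP.
have e0 : w = w 0 0 *: delta_mx 0 0.
  apply/colP => j; rewrite !mxE andbT; case: (eqVneq j 0) => [-> | hj].
    by rewrite mulr1.
  by rewrite mulr0 (w_top d) // subnn lt0n.
have w00 : w 0 0 != 0 by apply: contraNneq w0 => h; rewrite e0 h scale0r.
have Sdelta m : (m <= d)%N -> S (delta_mx (inord m) 0).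
  elim: m => [|m IH] hm.
    have -> : inord 0 = 0 :> 'I_d.+1 by apply/val_inj; rewrite /= inordK.
    by rewrite -[delta_mx _ _](scalerK w00) -e0; apply: SZ.
  have -> : delta_mx (inord m.+1) 0 = OX d a b c *m delta_mx (inord m) 0
      - Otheta a d m *: delta_mx (inord m) 0 :> 'cV[C]_d.+1.
    apply/colP => j; rewrite -colE !mxE -!val_eqE /= !inordK //; last by lia.
    rewrite !andbT; case: (eqVneq (j : nat) m) => [->|_].
      by rewrite (ltn_eqF (ltnSn m)) mulr1 subrr.
    by rewrite mulr0 subr0; case: eqP.
  have Sm : S (delta_mx (inord m) 0) by apply: IH; lia.
  by apply: invariantB; [apply: SX | apply: SZ].
move=> u; rewrite [u]matrix_sum_delta; apply: big_ind => // i _.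
rewrite big_ord1; apply: SZ; have := Sdelta i; rewrite inord_val; apply.
by have := ltn_ord i; lia.
Qed.
End Triangular.

Section Ladder.
Variables (N : nat) (X Y Z : 'M[C]_N) (kap lam mu Om : C).
Hypothesis hXY : X *m Y + Y *m X = Z + kap%:M.
Hypothesis hYZ : Y *m Z + Z *m Y = X + lam%:M.
Hypothesis hZX : Z *m X + X *m Z = Y + mu%:M.
Hypothesis hOm : X *m X + Y *m Y + Z *m Z = Om%:M.

(** The shift of [Y] by [e / 2] absorbs the linear terms that the three relations leave in both
    expressions. *)
Lemma ladder_ops (e : C) : e ^+ 2 = 1 ->
  let T := Y - (e / 2)%:M in let A := X + e *: Z in
  T *m A + A *m T = (kap + e * lam)%:M /\ A *m A + T *m T = (Om + e * mu + 1 / 4)%:M.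
Proof.
have YX : Y *m X = Z + kap%:M - X *m Y by rewrite -hXY [X *m Y + _]addrC addrK.
have ZY : Z *m Y = X + lam%:M - Y *m Z by rewrite -hYZ [Y *m Z + _]addrC addrK.
have ZX : Z *m X = Y + mu%:M - X *m Z by rewrite -hZX addrK.
have ZZ : Z *m Z = Om%:M - X *m X - Y *m Y by rewrite -hOm -addrA -opprD addrC addKr.
move=> e2 /=; split; rewrite !(mulmxBl, mulmxBr, mulmxDl, mulmxDr) -!(scalemxAl, scalemxAr);
  rewrite !(mul_mx_scalar, mul_scalar_mx) ?YX ?ZY ?ZX ?ZZ;
  apply/matrixP => i j; move: (X *m Y) (Y *m Z) (X *m Z) (X *m X) (Y *m Y) => XY YZ' XZ XX YY;
  rewrite !mxE; case: (i == j); rewrite ?mulr1n ?mulr0n; by field: e2.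
Qed.
End Ladder.

Section Omod.
Variables (al be ga : R).
Hypothesis ed : ~~ odd d.
Local Notation s j := (be - d%:R / 2 + j%:R).
Hypothesis be_lt : be + d%:R / 2 < 0.
Hypothesis hA : forall j : nat, ~~ odd j -> (0 < j <= d)%N -> (al + ga) ^+ 2 != (s j - 1 / 2) ^+ 2.
Hypothesis hB : forall j : nat, odd j -> (j <= d)%N -> (al - ga) ^+ 2 != (s j - 1 / 2) ^+ 2.

Lemma Otheta_cR (x : R) (j : nat) :
  Otheta (cR x) d j = cR ((-1) ^+ j * (x - d%:R / 2 + j%:R)).
Proof.
rewrite /Otheta cRE !(rmorphM, rmorphD, rmorphN, rmorphXn, rmorph1, fmorphV, rmorph_nat).
by field.
Qed.

Lemma s_lt0 j : (j <= d)%N -> s j < 0.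
Proof.
rewrite -(ler_nat R) => h; move: be_lt => ?; have ? : 0 <= d%:R :> R by []; lra.
Qed.

Local Notation a := (cR al).
Local Notation b := (cR be).
Local Notation c := (cR ga).
Local Notation X := (OX d a b c).
Local Notation Y := (OY d a b c).
Local Notation Z := (OZ d a b c).

(** With [P = a + e c] and [Q = b - e (d + 1) / 2], the constants of [ladder] are [M = P^2 + Q^2]
    and [k = 2 P Q], so its norm is [-(P^2 - x^2)(Q^2 - x^2) / x^2]. *)
Lemma ladder_norm_neq0 (e : R) (x : R) : e ^+ 2 = 1 -> x != 0 ->
  (al + e * ga) ^+ 2 != x ^+ 2 -> (be - e * d.+1%:R / 2) ^+ 2 != x ^+ 2 ->
  (a ^+ 2 + b ^+ 2 + c ^+ 2 + (d.+1%:R ^+ 2 - 1) / 4) + cR e * (2 * c * a - b * d.+1%:R) + 1 / 4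
    - cR x ^+ 2 - ((2 * a * b - c * d.+1%:R + cR e * (2 * b * c - a * d.+1%:R)) / (2 * cR x)) ^+ 2
  != 0.
Proof.
move=> e2 x0 hP hQ.
have {}e2 : cR e ^+ 2 = 1 by rewrite cRE -rmorphXn e2 rmorph1.
have xC : cR x != 0 by rewrite cRE fmorph_eq0.
rewrite (_ : _ - _ = - ((a + cR e * c) ^+ 2 - cR x ^+ 2) *
  ((b - cR e * d.+1%:R / 2) ^+ 2 - cR x ^+ 2) / cR x ^+ 2); last first.
  by field: e2; rewrite xC.
rewrite mulf_neq0 ?invr_neq0 ?expf_neq0 // mulf_neq0 ?oppr_eq0 // subr_eq0.
  by move: hP; rewrite -(inj_eq cR_inj) cRE !(rmorphXn, rmorphD, rmorphM).
by move: hQ; rewrite -(inj_eq cR_inj) cRE !(rmorphXn, rmorphB, rmorphM, fmorphV, rmorph_nat).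
Qed.

Lemma Omod_down j (w : 'cV[C]_d.+1) : (j < d)%N -> Y *m w = Otheta b d j.+1 *: w -> w != 0 ->
  exists e k : C, let w' := (X + e *: Z) *m w - k *: w in
  Y *m w' = Otheta b d j *: w' /\ w' != 0.
Proof.
move=> jd hw w0.
(* This sign makes the eigenvalue of [w] equal to [e * s j.+1]. Shifted by [e / 2] it is
   [x = e * (s j.+1 - 1 / 2)], and [- x] shifted back is the eigenvalue of index [j]. *)
pose e : R := if odd j then 1 else -1.
have e2 : e ^+ 2 = 1 by rewrite /e; case: (odd j); ring.
have sj := s_lt0 jd; have sd := s_lt0 (leqnn d).
have jd' : j.+1%:R <= d%:R :> R by rewrite ler_nat.
have j0 : 0 <= j%:R :> R by [].
have hth : Otheta b d j.+1 = cR (e * s j.+1).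
  by rewrite Otheta_cR -signr_odd /= /e; case: (odd j); rewrite /= ?expr0 ?expr1.
have hth' : Otheta b d j = cR (- (e * s j)).
  by rewrite Otheta_cR -signr_odd /= /e; case: (odd j); rewrite /= ?expr0 ?expr1; congr cR; ring.
pose x := e * (s j.+1 - 1 / 2).
have x0 : x != 0.
  have e0 : e != 0 by rewrite /e; case: ifP; rewrite ?oppr_eq0 oner_eq0.
  by rewrite mulf_neq0 //; apply/eqP; lra.
have x2 : x ^+ 2 = (s j.+1 - 1 / 2) ^+ 2 by rewrite /x exprMn e2; ring.
have hP : (al + e * ga) ^+ 2 != x ^+ 2.
  rewrite x2 /e; case: (boolP (odd j)) => oj; last by rewrite mulN1r hB.
  by rewrite (mul1r ga) hA //= negbK.
have hQ : (be - e * d.+1%:R / 2) ^+ 2 != x ^+ 2.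
  rewrite x2 eqf_sqr negb_or -[j.+1%:R]natr1 -[d.+1%:R]natr1.
  move: sj sd jd'; rewrite -[j.+1%:R]natr1 => sj sd jd'.
  by rewrite /e; case: (odd j); apply/andP; split; apply/eqP; lra.
have e2C : cR e ^+ 2 = 1 by rewrite cRE -rmorphXn e2 rmorph1.
have O_XY : X *m Y + Y *m X = Z + (2 * a * b - c * d.+1%:R)%:M by rewrite OZ_def subrK.
have [hTA hAA] := ladder_ops O_XY (O_YZ a b c ed) (O_ZX a b c ed)
  (O_casimir a b c ed) e2C.
have hT : (Y - (cR e / 2)%:M) *m w = cR x *: w.
  rewrite mulmxBl hw mul_scalar_mx -scalerBl hth /x; congr (_ *: _).
  rewrite cRE !(rmorphM, rmorphB, rmorph1, fmorphV, rmorph_nat); ring.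
have xC : cR x != 0 by rewrite cRE fmorph_eq0.
have [] := ladder hTA hAA hT w0 xC (ladder_norm_neq0 e2 x0 hP hQ).
move=> h1 h2; exists (cR e); eexists; split; last exact: h2.
move/eqP: h1; rewrite mulmxBl mul_scalar_mx subr_eq => /eqP ->.
rewrite -scalerDl hth' /x; congr (_ *: _).
rewrite cRE !(rmorphM, rmorphB, rmorphN, rmorphD, rmorph1, fmorphV, rmorph_nat) -natr1; by field.
Qed.

Lemma Omod_irreducible : mat_irreducible (Omod d a b c).
Proof.
move=> S S0 SD SZ; rewrite /actX /actY /actZ /= => SXYZ.
have SX u : S u -> S (X *m u) by case/SXYZ.
have SY u : S u -> S (Y *m u) by case/SXYZ => _ [].
have SZ' u : S u -> S (Z *m u) by case/SXYZ => _ [].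
(* The submodule is an arbitrary predicate, so excluded middle decides whether it has a nonzero
   vector. *)
have [[u [Su u0]]|h] := classic (exists u, S u /\ u <> 0); last first.
  by left=> u Su; apply: NNPP => u0; apply: h; exists u.
right; have [|j [w [jd Sw w0 hw]]] := invariant_eigenvector SD SZ SY (m := d.+1) Su (introN eqP u0).
  by move=> j; rewrite leqNgt ltn_ord.
have SB' := invariantB SD SZ.
elim: j w jd Sw w0 hw => [|j IH] w jd Sw w0 hw.
  apply: (invariant_full S0 SD SZ SX (w := w)) => // j /andP[j0 jd'].
  (* An odd [j] gives a positive value against [s 0 < 0], an even [j > 0] a value larger than
     [s 0]. *)
  rewrite !Otheta_cR (inj_eq cR_inj) expr0 mul1r.
  have := s_lt0 jd'; have := s_lt0 (leq0n d); rewrite -signr_odd.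
  have : (0 : R) < j%:R by rewrite ltr0n.
  by case: (odd j) => /=; rewrite ?expr1 ?expr0 => ???; apply/eqP; lra.
have [e [k [hw' w'0]]] := Omod_down jd hw w0.
apply: IH hw' => //; first exact: ltnW.
by rewrite mulmxDl -scalemxAl; apply: SB'; [apply: SD; [apply: SX|apply/SZ/SZ']|apply: SZ].
Qed.
End Omod.
End Irreducible.

(** * Isomorphisms between twists *)

Section TwistIso.
Variable R : rcfType.
Local Notation C := (complex R).
Variable d : nat.
Hypothesis ed : ~~ odd d.

Lemma OX_char_poly (a b c e : C) :
  char_poly (e *: OX d a b c) = \prod_(i < d.+1) ('X - (e * Otheta a d i)%:P).
Proof.
rewrite char_poly_trig; last first.
  apply/is_trig_mxP => i j ij; rewrite !mxE; case: eqP => [h|_]; first by lia.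
  by case: eqP => [h|_]; [lia | rewrite mulr0].
by apply: eq_bigr => i _; rewrite !mxE eqxx.
Qed.

Lemma OX_eigenvalue (a b c e s : C) :
  reflect (exists2 j, (j <= d)%N & s = e * Otheta a d j) (eigenvalue (e *: OX d a b c) s).
Proof.
rewrite eigenvalue_root_char OX_char_poly.
rewrite (_ : \prod_(i < d.+1) _ = \prod_(i <- map (fun i : 'I_d.+1 => e * Otheta a d i) (enum 'I_d.+1))
  ('X - i%:P)); last by rewrite big_map big_enum.
rewrite root_prod_XsubC; apply: (iffP mapP) => [[i _ ->]|[j jd ->]].
  by exists i => //; have := ltn_ord i; lia.
by exists (inord j); rewrite ?mem_enum // inordK //; lia.
Qed.

Lemma OX_unitmx (a b c e s : C) :
  (forall j, (j <= d)%N -> s != e * Otheta a d j) -> e *: OX d a b c - s%:M \in unitmx.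
Proof.
move=> h; rewrite -row_free_unit -kermx_eq0; apply/negPn/negP => hs.
have /(OX_eigenvalue a b c) [j jd hj] : eigenvalue (e *: OX d a b c) s by exact: hs.
by move: (h j jd); rewrite -hj eqxx.
Qed.

(** [revphi] depends on [a] and [b] only through their sum, and so does [2 theta theta* - 2 a b] in
    the diagonal entry. *)
Lemma OZ_shift (a b a' b' c : C) : a + b = a' + b' -> OZ d a b c = OZ d a' b' c.
Proof.
move=> h; have {h} -> : a = a' + b' - b by rewrite -h addrK.
apply: revrow_ext => m.
rewrite (verma_Z (revrow_X _ b c ed) (revrow_Y _ b c ed) (OZ_def _ _ _ _)).
rewrite (verma_Z (revrow_X a' b' c ed) (revrow_Y a' b' c ed) (OZ_def _ _ _ _)).
have -> : revphi (a' + b' - b) b c d m = revphi a' b' c d m.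
  by rewrite /revphi; case: (odd m); congr (_ / _); ring.
congr (_ *: _ + _ - _); rewrite /revzeta /revtheta /revphi /=.
by case: (signP R m) => -[-> ->] /=; field.
Qed.

Lemma verma_row_horner (a : C) (X : 'M[C]_d.+1) e m :
  verma_row a X e m = e *m horner_mx X (\prod_(i < m) ('X - (revtheta a d i)%:P)).
Proof.
elim: m => [|m IH]; first by rewrite big_ord0 rmorph1 mulmx1.
rewrite /= big_ord_recr rmorphM /= mulmxA -IH rmorphB /= horner_mx_X horner_mx_C.
by rewrite mulmxBr mul_mx_scalar.
Qed.

Lemma horner_intertwine (P A B : 'M[C]_d.+1) p :
  P *m A = B *m P -> P *m horner_mx A p = horner_mx B p *m P.
Proof.
move=> h; elim/poly_ind: p => [|p x IH]; first by rewrite !rmorph0 mulmx0 mul0mx.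
rewrite !(rmorphD, rmorphM) /= !horner_mx_X !horner_mx_C mulmxDr mulmxDl.
by rewrite mul_mx_scalar mul_scalar_mx !mulmxA IH -!mulmxA h.
Qed.

(** Cayley-Hamilton for the triangular [OX], transported along the isomorphism. By
    [verma_row_horner] this product is what makes a Verma-type sequence stop at [d + 1]. *)
Lemma mat_iso_horner (a b c : C) (M : mat3 R d) : mat_iso M (Omod d a b c) ->
  horner_mx (actX M) (\prod_(i < d.+1) ('X - (revtheta a d i)%:P)) = 0.
Proof.
move=> [P [Pu [PX _ _]]].
rewrite (reindex_inj rev_ord_inj) /=.
rewrite (eq_bigr (fun i : 'I_d.+1 => 'X - (1 * Otheta a d i)%:P)); last first.
  move=> i _; rewrite subSS mul1r -(Otheta_rev ed) ?leq_subr // subKn //.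
  by have := ltn_ord i; lia.
rewrite -(OX_char_poly a b c) scale1r.
apply: (can_inj (mulKmx Pu)).
by rewrite (horner_intertwine _ PX) Cayley_Hamilton mul0mx mulmx0.
Qed.

Variables (al e : R) (b c : C).
Local Notation a := (cR al).
Hypothesis e2 : e ^+ 2 = 1.
Local Notation X := (OX d a b c).
Local Notation Y := (OY d a b c).
Local Notation Z := (OZ d a b c).
Local Notation th j := (e * ((-1) ^+ j * (al - d%:R / 2 + j%:R))).

Lemma eOtheta j : cR e * Otheta a d j = cR (th j).
Proof. by rewrite Otheta_cR cRE [in RHS]rmorphM. Qed.

(** The relations are cyclically symmetric, so [(Z, e X, e Y)] satisfies those of [O_d(c, e a, e b)]
    and [mat_iso_Omod] applies. The conditions on eigenvalues provide, in order, the starting row,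
    the invertibility [hu] and the end of the sequence. *)
Lemma twist_iso :
  mat_irreducible (Z, cR e *: X, cR e *: Y) ->
  (exists2 j, (j <= d)%N & e * al + d%:R / 2 = th j) ->
  (forall j, (j <= d)%N -> - (e * al + d%:R / 2 + 1) != th j) ->
  (forall j, (j <= d)%N -> d%:R / 2 + 1 - e * al != th j) \/
    horner_mx Z (\prod_(i < d.+1) ('X - (revtheta c d i)%:P)) = 0 ->
  mat_iso (Z, cR e *: X, cR e *: Y) (Omod d c (cR e * a) (cR e * b)).
Proof.
move=> irr [j jd hj] hbase hend.
have e2C : cR e * cR e = 1 by rewrite cRE -rmorphM -expr2 e2 rmorph1.
have [|v hv v0] := eigenvalueP (_ : eigenvalue (cR e *: X) (cR e * a + d%:R / 2)).
  apply/OX_eigenvalue; exists j => //; rewrite eOtheta -hj.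
  by rewrite cRE !(rmorphD, rmorphM, fmorphV, rmorph_nat).
have hu : cR e *: X + (cR e * a + d%:R / 2 + 1)%:M \in unitmx.
  rewrite -[_ + 1]opprK raddfN /=; apply: OX_unitmx => i /hbase hi.
  rewrite eOtheta; move: hi; rewrite -(inj_eq (@cR_inj R)).
  by rewrite cRE !(rmorphD, rmorphN, rmorphM, rmorph1, fmorphV, rmorph_nat).
have hXY : Z *m (cR e *: X) + (cR e *: X) *m Z = cR e *: Y +
    (2 * c * (cR e * a) - (cR e * b) * d.+1%:R)%:M.
  rewrite -scalemxAl -scalemxAr -scalerDr O_ZX // scalerDr scale_scalar_mx.
  by congr (_ + _%:M); ring.
have hYZ : (cR e *: X) *m (cR e *: Y) + (cR e *: Y) *m (cR e *: X) = Z +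
    (2 * (cR e * a) * (cR e * b) - c * d.+1%:R)%:M.
  rewrite -!scalemxAl -!scalemxAr !scalerA e2C !scale1r OZ_def.
  have -> : 2 * (cR e * a) * (cR e * b) = 2 * a * b by ring: e2C.
  by rewrite subrK.
have hZX : (cR e *: Y) *m Z + Z *m (cR e *: Y) = cR e *: X +
    (2 * (cR e * b) * c - (cR e * a) * d.+1%:R)%:M.
  rewrite -scalemxAl -scalemxAr -scalerDr O_YZ // scalerDr scale_scalar_mx.
  by congr (_ + _%:M); ring.
apply: (mat_iso_Omod ed hXY hYZ hZX hv hu irr v0).
case: hend => [hend|h0]; last by rewrite verma_row_horner h0 mulmx0.
have [hv1 _] := verma_row_YZ hXY hYZ hZX hv hu d.+1 v0.
(* As [revphi] vanishes at [d + 1], a nonzero [verma_row d.+1] would be an eigenvector of [e X] for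
   the value excluded by [hend]. *)
apply: (can_inj (mulmxK (OX_unitmx (a := a) b c (e := cR e) (s := revtheta (cR e * a) d d.+1) _))).
  move=> i /hend; rewrite eOtheta -(inj_eq (@cR_inj R)).
  congr (_ != _); rewrite /revtheta -signr_odd /= ed expr1 cRE !(rmorphD, rmorphN, rmorphM, rmorph1, fmorphV, rmorph_nat) -natr1.
  by field.
rewrite mul0mx mulmxBr hv1 mul_mx_scalar [_ *: _ + _]addrC addrK.
by rewrite /revphi /= ed natr1 subrr !mul0r scale0r.
Qed.
End TwistIso.

Section RealEmbedding.
Variable R : rcfType.
Implicit Types x y : R.
Lemma cRD x y : cR (x + y) = cR x + cR y. Proof. exact: (rmorphD (real_complex R)). Qed.
Lemma cRN x : cR (- x) = - cR x. Proof. exact: (rmorphN (real_complex R)). Qed.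
Lemma cRM x y : cR (x * y) = cR x * cR y. Proof. exact: (rmorphM (real_complex R)). Qed.
Lemma cRV x : cR x^-1 = (cR x)^-1. Proof. exact: (fmorphV (real_complex R)). Qed.
Lemma cR_nat n : cR n%:R = n%:R :> complex R. Proof. exact: (rmorph_nat (real_complex R)). Qed.
Lemma cR1 : cR 1 = 1 :> complex R. Proof. by []. Qed.
Lemma cR0 : cR 0 = 0 :> complex R. Proof. by []. Qed.
End RealEmbedding.

(** * Irreducibility under twists *)

Section Twists.
Variables (R : rcfType) (d : nat) (M : mat3 R d).

Lemma irreducible_twist132 : mat_irreducible M -> mat_irreducible (twist132 M).
Proof.
move=> irr S S0 SD SZ SM; apply: irr => // u Su.
by have [? [? ?]] := SM u Su; split.
Qed.

Lemma irreducible_twistmm132 : mat_irreducible M -> mat_irreducible (twistmm132 M).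
Proof.
move=> irr S S0 SD SZ SM; apply: irr => // u Su.
have [h1 [h2 h3]] := SM u Su; split; first by rewrite -[_ *m u]opprK -mulNmx -scaleN1r; apply: SZ.
by split=> //; rewrite -[_ *m u]opprK -mulNmx -scaleN1r; apply: SZ.
Qed.
End Twists.

Lemma twistmm132E (R : rcfType) d (a b c : complex R) : twistmm132 (Omod d a b c) =
  (OZ d a b c, cR (-1) *: OX d a b c, cR (-1) *: OY d a b c).
Proof. by rewrite cRN cR1 !scaleN1r. Qed.

Lemma twist132E (R : rcfType) d (a b c : complex R) : twist132 (Omod d a b c) =
  (OZ d a b c, cR 1 *: OX d a b c, cR 1 *: OY d a b c).
Proof. by rewrite cR1 !scale1r. Qed.

(** * The modules [W_1] and [W_2] for nonnegative [k1] and [k2] *)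

Section Concrete.
Variables (R : rcfType) (k2 k3 : R) (n t : nat).
Local Notation C := (complex R).
Hypotheses (ot : odd t) (k3t : 2 * k3 = - t%:R) (on : odd n) (tn : (t <= n)%N).
Hypothesis (k2_ge0 : 0 <= k2).

Lemma half_cR : (n.+1)%:R / 2 = cR (n.+1%:R / 2) :> C.
Proof. by rewrite cRM cRV !cR_nat. Qed.

Section K1.
Variable k1 : R.
Hypothesis k1_ge0 : 0 <= k1.
Local Notation K := (cR (k1 + k2 + k3)).
Local Notation h := (cR (n.+1%:R / 2)).

(** With [d = n - t], the absolute value of [s j - 1/2] is [k1 + k2 + d + 1 - j]. It lies strictly
    between [|al + ga| = |k1 - k2|] and [al - ga = k1 + k2 + n + 1]. *)
Lemma W1_irreducible :
  mat_irreducible (Omod (n - t) (cR k1 + h) (- K - h) (- cR k2 - h)).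
Proof.
have [k3E k1p k2p] := And3 k3t k1_ge0 k2_ge0.
rewrite -?cR_nat -!(cRN, cRD).
have d_eq : (n - t)%:R = n%:R - t%:R :> R by rewrite natrB.
apply: Omod_irreducible; rewrite ?oddB ?ot ?on // d_eq -natr1.
- lra.
- move=> j ej /andP[j0 jd]; rewrite eqf_sqr negb_or.
  have : j%:R <= (n - t)%:R :> R by rewrite ler_nat.
  by rewrite d_eq => ?; apply/andP; split; apply/eqP; lra.
- move=> j oj jd; rewrite eqf_sqr negb_or.
  have : j%:R <= (n - t)%:R :> R by rewrite ler_nat.
  have : 0 <= j%:R :> R by [].
  have : 1 <= t%:R :> R by rewrite ler1n; case: (t) ot.
  by rewrite d_eq => ???; apply/andP; split; apply/eqP; lra.
Qed.

(** Here the absolute value of [s j - 1/2] is [k1 + k2 + n + 1 - j], larger than both [k1 + k2] and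
    [|k1 - k2|] because [j < t <= n]. *)
Lemma W2_irreducible : mat_irreducible (Omod t.-1 (cR k1) (- K - n.+1%:R) (cR k2)).
Proof.
have [k3E k1p k2p] := And3 k3t k1_ge0 k2_ge0.
rewrite -?cR_nat -!(cRN, cRD).
have t0 : (0 < t)%N by case: (t) ot.
have d_eq : t.-1%:R = t%:R - 1 :> R by rewrite -[in RHS](prednK t0) -natr1 addrK.
have tnR : t%:R <= n%:R :> R by rewrite ler_nat.
have nE : n.+1%:R = n%:R + 1 :> R by rewrite natr1.
apply: Omod_irreducible; rewrite ?d_eq ?nE.
- by case: (t) ot.
- lra.
- move=> j ej /andP[j0 jd]; rewrite eqf_sqr negb_or.
  have : j%:R <= t.-1%:R :> R by rewrite ler_nat.
  by rewrite d_eq => ?; apply/andP; split; apply/eqP; lra.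
- move=> j oj jd; rewrite eqf_sqr negb_or.
  have : j%:R <= t.-1%:R :> R by rewrite ler_nat.
  by rewrite d_eq => ?; apply/andP; split; apply/eqP; lra.
Qed.

Lemma W1_iso : mat_iso (twistmm132 (Omod (n - t) (cR k1 + h) (- K - h) (- cR k2 - h)))
  (Omod (n - t) (- cR k2 - h) (- cR k1 - h) (K + h)).
Proof.
have [k3E k1p k2p] := And3 k3t k1_ge0 k2_ge0.
have := irreducible_twistmm132 W1_irreducible.
have d_eq : (n - t)%:R = n%:R - t%:R :> R by rewrite natrB.
have nE : n.+1%:R = n%:R + 1 :> R by rewrite natr1.
have ed : ~~ odd (n - t) by rewrite oddB ?ot ?on.
have -> : cR k1 + h = cR (k1 + n.+1%:R / 2) by rewrite cRD.
have -> : - cR k1 - h = cR (-1) * cR (k1 + n.+1%:R / 2).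
  by rewrite -cRM mulN1r opprD cRD !cRN.
have -> : K + h = cR (-1) * (- K - h) by rewrite cRN cR1 mulN1r opprD !opprK.
rewrite twistmm132E => irr.
apply: (twist_iso ed _ irr); rewrite ?sqrrN ?expr1n // ?d_eq.
(* With the sign [-1] the starting eigenvalue is the diagonal entry of index [0]; with the sign [1],
   as for [W_2], it is the last one. *)
- exists 0%N => //; rewrite expr0 nE; lra.
- move=> j jd; have j0 : 0 <= j%:R :> R by [].
  rewrite -signr_odd nE; apply/eqP.
  have : 1 <= t%:R :> R by rewrite ler1n; case: (t) ot.
  by case: (odd j); rewrite /= ?expr1 ?expr0 => ?; lra.
- left=> j jd; have jdR : j%:R <= n%:R - t%:R :> R by rewrite -d_eq ler_nat.
  have j0 : 0 <= j%:R :> R by [].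
  have tnR : t%:R <= n%:R :> R by rewrite ler_nat.
  have tR : 0 <= t%:R :> R by [].
  rewrite -signr_odd nE; apply/eqP.
  by case: (odd j); rewrite /= ?expr1 ?expr0; lra.
Qed.

(* For [k1 > 0] the eigenvalue criterion can fail.  But [Z] of [O_d(a,b,c)] depends
   only on [a + b] and [c], so its characteristic equation can be read off at [k1 = 0]. *)
Lemma W2_iso_end :
  k1 = 0 \/ horner_mx (OZ t.-1 (cR k1) (- K - n.+1%:R) (cR k2))
    (\prod_(i < t.-1.+1) ('X - (revtheta (cR k2) t.-1 i)%:P)) = 0 ->
  mat_iso (twist132 (Omod t.-1 (cR k1) (- K - n.+1%:R) (cR k2)))
    (Omod t.-1 (cR k2) (cR k1) (- K - n.+1%:R)).
Proof.
move=> hend.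
have [k3E k1p k2p] := And3 k3t k1_ge0 k2_ge0.
have := irreducible_twist132 W2_irreducible.
have t0 : (0 < t)%N by case: (t) ot.
have d_eq : t.-1%:R = t%:R - 1 :> R by rewrite -[in RHS](prednK t0) -natr1 addrK.
have ed : ~~ odd t.-1 by case: (t) ot.
rewrite (_ : Omod _ (cR k2) _ _ = Omod t.-1 (cR k2) (cR 1 * cR k1) (cR 1 * (- K - n.+1%:R)));
  last by rewrite cR1 !mul1r.
rewrite twist132E => irr.
apply: (twist_iso ed _ irr); rewrite ?expr1n // ?d_eq.
- by exists t.-1; rewrite // -signr_odd (negbTE ed) expr0 d_eq; lra.
- move=> j jd; have j0 : 0 <= j%:R :> R by [].
  have jdR : j%:R <= t%:R - 1 :> R by rewrite -d_eq ler_nat.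
  rewrite -signr_odd; apply/eqP.
  by case: (odd j); rewrite /= ?expr1 ?expr0; lra.
- case: hend => [k10|]; [left=> j jd|by right].
  have jdR : j%:R <= t%:R - 1 :> R by rewrite -d_eq ler_nat.
  have j0 : 0 <= j%:R :> R by [].
  rewrite -signr_odd k10; apply/eqP.
  by case: (odd j); rewrite /= ?expr1 ?expr0; lra.
Qed.
End K1.

Lemma W2_iso (k1 : R) : 0 <= k1 ->
  mat_iso (twist132 (Omod t.-1 (cR k1) (- cR (k1 + k2 + k3) - n.+1%:R) (cR k2)))
    (Omod t.-1 (cR k2) (cR k1) (- cR (k1 + k2 + k3) - n.+1%:R)).
Proof.
move=> k1_ge0; apply: W2_iso_end => //; right.
have ed : ~~ odd t.-1 by case: (t) ot.
rewrite -(mat_iso_horner ed (W2_iso_end (lexx 0) (or_introl erefl))) /=.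
(* Both sums [a + b] equal [-(k2 + k3) - (n + 1)]. *)
congr (horner_mx _ _); apply: OZ_shift => //.
by rewrite !cRD cR0; ring.
Qed.
End Concrete.

(** * Coefficients of spinors *)

Definition mnm3 (a b c : nat) : 'X_{1..3} :=
  [multinom (match val i with 0 => a | 1 => b | _ => c end) | i < 3].

Lemma mnm3E (m : 'X_{1..3}) : m = mnm3 (m x1) (m x2) (m x3).
Proof.
apply/(mnmP m) => i; rewrite mnmE.
by case: i => [[|[|[|i]]] hi] //=; congr (m _); apply/val_inj.
Qed.

Lemma mnm3_1 a b c : mnm3 a b c x1 = a. Proof. by rewrite mnmE. Qed.
Lemma mnm3_2 a b c : mnm3 a b c x2 = b. Proof. by rewrite mnmE. Qed.
Lemma mnm3_3 a b c : mnm3 a b c x3 = c. Proof. by rewrite mnmE. Qed.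
Lemma mdeg_mnm3 a b c : mdeg (mnm3 a b c) = (a + b + c)%N.
Proof. by rewrite mdegE !big_ord_recl big_ord0 !mnmE /= addn0 addnA. Qed.
Lemma mnm3D1 a b c : (mnm3 a b c + U_(x1))%MM = mnm3 a.+1 b c.
Proof. by apply/mnmP => -[[|[|[|i]]] hi] //; rewrite mnmDE mnm1E !mnmE /= ?addn0 ?addn1. Qed.
Lemma mnm3D2 a b c : (mnm3 a b c + U_(x2))%MM = mnm3 a b.+1 c.
Proof. by apply/mnmP => -[[|[|[|i]]] hi] //; rewrite mnmDE mnm1E !mnmE /= ?addn0 ?addn1. Qed.
Lemma mnm3D3 a b c : (mnm3 a b c + U_(x3))%MM = mnm3 a b c.+1.
Proof. by apply/mnmP => -[[|[|[|i]]] hi] //; rewrite mnmDE mnm1E !mnmE /= ?addn0 ?addn1. Qed.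
Lemma mnm3B1 a b c : (mnm3 a.+1 b c - U_(x1))%MM = mnm3 a b c.
Proof. by rewrite -mnm3D1 addmK. Qed.
Lemma mnm3B2 a b c : (mnm3 a b.+1 c - U_(x2))%MM = mnm3 a b c.
Proof. by rewrite -mnm3D2 addmK. Qed.
Lemma mnm3B3 a b c : (mnm3 a b c.+1 - U_(x3))%MM = mnm3 a b c.
Proof. by rewrite -mnm3D3 addmK. Qed.

(* Sealed: comparing two unequal instances up to conversion would unfold the
   polynomial operations. *)
HB.lock Definition coef3 (R : rcfType) (p : Pol R) (a b c : nat) : complex R :=
  p@_(mnm3 a b c).

HB.lock Definition lockdunkl (R : rcfType) (k : 'I_3 -> R) (i : 'I_3) (p : Pol R) : Pol R :=
  dunkl k i p.
HB.lock Definition lockrefl (R : rcfType) (i : 'I_3) (p : Pol R) : Pol R := refl i p.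
HB.lock Definition lockmulX (R : rcfType) (i : 'I_3) (p : Pol R) : Pol R := 'X_i * p.

Lemma lockdunklE (R : rcfType) (k : 'I_3 -> R) i p : lockdunkl k i p = dunkl k i p.
Proof. by rewrite unlock. Qed.
Lemma lockreflE (R : rcfType) i (p : Pol R) : lockrefl i p = refl i p.
Proof. by rewrite unlock. Qed.
Lemma lockmulXE (R : rcfType) i (p : Pol R) : lockmulX i p = 'X_i * p.
Proof. by rewrite unlock. Qed.

Lemma coef3E (R : rcfType) (p : Pol R) a b c : coef3 p a b c = p@_(mnm3 a b c).
Proof. by rewrite unlock. Qed.

Section Coefficients.
Variable R : rcfType.
Local Notation C := (complex R).
Local Notation Pol := (Pol R).
Local Notation V := (V R).

(* [T_i x_i^j = bracket k_i j * x_i^(j-1)]. *)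
Definition bracket (x : R) (j : nat) : C := j%:R + (if odd j then 2 * cR x else 0).

Lemma refl_coef (i : 'I_3) (p : Pol) m : (refl i p)@_m = (-1) ^+ (m i) * p@_m.
Proof.
have reflX m' : refl i 'X_[m'] = (-1) ^+ (m' i) *: 'X_[m'] :> Pol.
  rewrite /refl comp_mpolyX (bigD1 i) //= tnth_mktuple eqxx -scaleN1r exprZn -scalerAl.
  rewrite [X in _ = _ *: X]mpolyXE_id [in RHS](bigD1 i) //=; congr (_ *: (_ * _)).
  by apply: eq_bigr => j /negbTE ji; rewrite tnth_mktuple ji.
rewrite [in LHS](mpolyE p) {1}/refl (raddf_sum (comp_mpoly _)) /= raddf_sum /=.
rewrite [in RHS](mpolyE p) raddf_sum /= mulr_sumr; apply: eq_bigr => m' _.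
rewrite comp_mpolyZ -[X in mcoeff _ (_ *: X)]/(refl i _) reflX !mcoeffZ mcoeffX.
by case: eqP => [->|]; rewrite ?mulr0 // !mulr1 mulrC.
Qed.

Lemma divX_coef (i : 'I_3) (q : Pol) m : (divX i q)@_m = q@_(m + U_(i))%MM.
Proof.
rewrite /divX raddf_sum /=.
transitivity (\sum_(m' <- msupp q) (if m' == (m + U_(i))%MM then q@_m' else 0)); last first.
  case: (boolP ((m + U_(i))%MM \in msupp q)) => h; last first.
    rewrite big_seq big1 ?memN_msupp_eq0 // => m' hm'.
    by case: eqP => // e; case/negP: h; rewrite -e.
  by rewrite (bigD1_seq _ h) //= eqxx big1 ?addr0 // => m' /negbTE ->.
rewrite big_mkcond; apply: eq_bigr => m' _; rewrite mcoeffZ mcoeffX.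
case: (ltnP 0 (m' i)) => h.
  have -> : (m' - U_(i) == m)%MM = (m' == m + U_(i))%MM.
    apply/eqP/eqP => [<-|->]; last by rewrite addmK.
    by rewrite submK // lep1mP -lt0n.
  by case: eqP; rewrite ?mulr1 ?mulr0.
by case: eqP => // e; move: h; rewrite e mnmDE mnm1E eqxx addn1.
Qed.

(** [p - refl i p] doubles the odd powers of [x_i] and kills the even ones, whence the term [2 k_i]
    of [bracket]. *)
Lemma dunkl_coef (k : 'I_3 -> R) i (p : Pol) m :
  (dunkl k i p)@_m = bracket (k i) (m i).+1 * p@_(m + U_(i))%MM.
Proof.
rewrite /dunkl mcoeffD mcoeff_mderiv mcoeffZ divX_coef mcoeffB refl_coef.
rewrite mnmDE mnm1E eqxx addn1 /bracket /= exprS -signr_odd -mulr_natl.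
by case: (odd (m i)); rewrite /= ?expr1 ?expr0; ring.
Qed.

Lemma mulX_coef (i : 'I_3) (p : Pol) m :
  ('X_i * p)@_m = if (0 < m i)%N then p@_(m - U_(i))%MM else 0.
Proof.
case: ltnP => h.
  have em : (m - U_(i) + U_(i))%MM = m by rewrite submK // lep1mP -lt0n.
  by rewrite mulrC -[in LHS]em addmC mcoeffMX.
rewrite [p]mpolyE mulr_sumr raddf_sum /= big1 // => m' _.
rewrite -scalerAr mcoeffZ -mpolyXD mcoeffX; case: eqP => [e|]; last by rewrite mulr0.
by move: h; rewrite -e mnmDE mnm1E eqxx.
Qed.

Lemma coef3_inj (p q : Pol) : (forall a b c, coef3 p a b c = coef3 q a b c) -> p = q.
Proof. by move=> h; apply/mpolyP => m; have := h (m x1) (m x2) (m x3); rewrite !coef3E -!mnm3E. Qed.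

Lemma coef3D (p q : Pol) a b c : coef3 (p + q) a b c = coef3 p a b c + coef3 q a b c.
Proof. by rewrite !coef3E mcoeffD. Qed.
Lemma coef3N (p : Pol) a b c : coef3 (- p) a b c = - coef3 p a b c.
Proof. by rewrite !coef3E mcoeffN. Qed.
Lemma coef3Z (s : C) (p : Pol) a b c : coef3 (s *: p) a b c = s * coef3 p a b c.
Proof. by rewrite !coef3E mcoeffZ. Qed.
Lemma coef30 a b c : coef3 (0 : Pol) a b c = 0.
Proof. by rewrite !coef3E mcoeff0. Qed.

Lemma homogeneousP n (p : Pol) :
  reflect (forall a b c, (a + b + c)%N != n -> coef3 p a b c = 0) (homogeneous n p).
Proof.
apply: (iffP allP) => h.
  move=> a b c; rewrite -mdeg_mnm3 => hn; rewrite coef3E; apply: memN_msupp_eq0.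
  by apply: contra hn => /h.
move=> m; rewrite mcoeff_msupp (mnm3E m) mdeg_mnm3; apply: contraNT => hn.
by apply/eqP; rewrite -coef3E; apply: h.
Qed.

Variables (k1 k2 k3 : R).
Local Notation k := (kvec k1 k2 k3).

Lemma coef3_dunkl1 (p : Pol) a b c : coef3 (lockdunkl k x1 p) a b c = bracket k1 a.+1 * coef3 p a.+1 b c.
Proof. by rewrite !coef3E lockdunklE dunkl_coef mnm3_1 mnm3D1. Qed.
Lemma coef3_dunkl2 (p : Pol) a b c : coef3 (lockdunkl k x2 p) a b c = bracket k2 b.+1 * coef3 p a b.+1 c.
Proof. by rewrite !coef3E lockdunklE dunkl_coef mnm3_2 mnm3D2. Qed.
Lemma coef3_dunkl3 (p : Pol) a b c : coef3 (lockdunkl k x3 p) a b c = bracket k3 c.+1 * coef3 p a b c.+1.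
Proof. by rewrite !coef3E lockdunklE dunkl_coef mnm3_3 mnm3D3. Qed.
Lemma coef3_refl1 (p : Pol) a b c : coef3 (lockrefl x1 p) a b c = (-1) ^+ a * coef3 p a b c.
Proof. by rewrite !coef3E lockreflE refl_coef mnm3_1. Qed.
Lemma coef3_refl2 (p : Pol) a b c : coef3 (lockrefl x2 p) a b c = (-1) ^+ b * coef3 p a b c.
Proof. by rewrite !coef3E lockreflE refl_coef mnm3_2. Qed.
Lemma coef3_refl3 (p : Pol) a b c : coef3 (lockrefl x3 p) a b c = (-1) ^+ c * coef3 p a b c.
Proof. by rewrite !coef3E lockreflE refl_coef mnm3_3. Qed.
Lemma coef3_X1 (p : Pol) a b c : coef3 (lockmulX x1 p) a b c = if a is a'.+1 then coef3 p a' b c else 0.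
Proof. by rewrite coef3E lockmulXE mulX_coef mnm3_1; case: a => //= a; rewrite mnm3B1 coef3E. Qed.
Lemma coef3_X2 (p : Pol) a b c : coef3 (lockmulX x2 p) a b c = if b is b'.+1 then coef3 p a b' c else 0.
Proof. by rewrite coef3E lockmulXE mulX_coef mnm3_2; case: b => //= b; rewrite mnm3B2 coef3E. Qed.
Lemma coef3_X3 (p : Pol) a b c : coef3 (lockmulX x3 p) a b c = if c is c'.+1 then coef3 p a b c' else 0.
Proof. by rewrite coef3E lockmulXE mulX_coef mnm3_3; case: c => //= c; rewrite mnm3B3 coef3E. Qed.

Definition spin (s : bool) (v : V) : Pol := if s then v.2 else v.1.

(* [D v = 0] solved for the coefficients of [x_1^(a+1)], see [Dirac_coef3]. *)
Definition cauchy_step (F : bool -> nat -> nat -> nat -> C) (s : bool) a b c : C :=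
  (-1) ^+ s * (- @iC R * bracket k2 b.+1 * F s a b.+1 c + bracket k3 c.+1 * F (~~ s) a b c.+1).

Lemma iC2 : @iC R * @iC R = -1.
Proof. by apply/eqP; rewrite eq_complex /= !mul0r !mulr0 !mulr1 sub0r addr0 oppr0 !eqxx. Qed.

(** This and [coef3_lin5] are the common shapes of the components of [Dirac] and of [X], [Y],
    [Z]. *)
Lemma coef3_lin3 (p : Pol) (s : C) (q r : Pol) a b c :
  coef3 (p + (s *: q + r)) a b c = coef3 p a b c + (s * coef3 q a b c + coef3 r a b c).
Proof. by rewrite coef3D; congr (_ + _); rewrite coef3D; congr (_ + _); exact: coef3Z. Qed.

Lemma coef3_lin5 (s0 s1 s2 s3 s4 : C) (p q p2 p3 p4 : Pol) a b c :
  coef3 (s1 *: (s0 *: (p - q)) + s2 *: p2 + (s3 *: p3 + s4 *: p4)) a b c =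
  s1 * (s0 * (coef3 p a b c - coef3 q a b c)) + s2 * coef3 p2 a b c +
  (s3 * coef3 p3 a b c + s4 * coef3 p4 a b c).
Proof.
rewrite coef3D; congr (_ + _); rewrite coef3D; congr (_ + _); try exact: coef3Z.
by rewrite coef3Z; congr (_ * _); rewrite coef3Z; congr (_ * _); rewrite coef3D; congr (_ + _); exact: coef3N.
Qed.

Lemma DiracE1 v : (Dirac k v).1 =
  lockdunkl k x1 v.2 + (- @iC R *: lockdunkl k x2 v.2 + lockdunkl k x3 v.1).
Proof. by rewrite !lockdunklE. Qed.

Lemma DiracE2 v : (Dirac k v).2 =
  lockdunkl k x1 v.1 + (@iC R *: lockdunkl k x2 v.1 + - lockdunkl k x3 v.2).
Proof. by rewrite !lockdunklE. Qed.

Definition lockang (i j : 'I_3) (p : Pol) : Pol :=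
  lockmulX i (lockdunkl k j p) - lockmulX j (lockdunkl k i p).

Lemma lockangE i j p : lockang i j p = ang k i j p.
Proof. by rewrite /lockang !lockmulXE !lockdunklE. Qed.

(** The scalar [1] in front of [lockang] gives all six components the shape of [coef3_lin5]. *)
Lemma opXE1 v : (opX k v).1 =
  @iC R *: (1 *: lockang x3 x2 (lockrefl x2 (lockrefl x3 v.2))) + cR (1 / 2) *: lockrefl x2 (lockrefl x3 v.1) +
  (cR k3 *: lockrefl x2 v.1 + cR k2 *: lockrefl x3 v.1).
Proof. by rewrite scale1r lockangE !lockreflE. Qed.
Lemma opXE2 v : (opX k v).2 =
  @iC R *: (1 *: lockang x3 x2 (lockrefl x2 (lockrefl x3 v.1))) + cR (1 / 2) *: lockrefl x2 (lockrefl x3 v.2) +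
  (cR k3 *: lockrefl x2 v.2 + cR k2 *: lockrefl x3 v.2).
Proof. by rewrite scale1r lockangE !lockreflE. Qed.
Lemma opYE1 v : (opY k v).1 =
  @iC R *: (- @iC R *: lockang x1 x3 (lockrefl x1 (lockrefl x3 v.2))) + cR (1 / 2) *: lockrefl x1 (lockrefl x3 v.1) +
  (cR k3 *: lockrefl x1 v.1 + cR k1 *: lockrefl x3 v.1).
Proof. by rewrite lockangE !lockreflE. Qed.
Lemma opYE2 v : (opY k v).2 =
  @iC R *: (@iC R *: lockang x1 x3 (lockrefl x1 (lockrefl x3 v.1))) + cR (1 / 2) *: lockrefl x1 (lockrefl x3 v.2) +
  (cR k3 *: lockrefl x1 v.2 + cR k1 *: lockrefl x3 v.2).
Proof. by rewrite lockangE !lockreflE. Qed.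
Lemma opZE1 v : (opZ k v).1 =
  @iC R *: (1 *: lockang x2 x1 (lockrefl x1 (lockrefl x2 v.1))) + cR (1 / 2) *: lockrefl x1 (lockrefl x2 v.1) +
  (cR k2 *: lockrefl x1 v.1 + cR k1 *: lockrefl x2 v.1).
Proof. by rewrite scale1r lockangE !lockreflE. Qed.
Lemma opZE2 v : (opZ k v).2 =
  @iC R *: (-1 *: lockang x2 x1 (lockrefl x1 (lockrefl x2 v.2))) + cR (1 / 2) *: lockrefl x1 (lockrefl x2 v.2) +
  (cR k2 *: lockrefl x1 v.2 + cR k1 *: lockrefl x2 v.2).
Proof. by rewrite scaleN1r lockangE !lockreflE. Qed.

Lemma Dirac_coef3 v : Dirac k v = (0, 0) <-> forall s a b c,
  bracket k1 a.+1 * coef3 (spin s v) a.+1 b c = cauchy_step (fun s => coef3 (spin s v)) s a b c.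
Proof.
(* [sigma_1] swaps the components, so the first component of the equation is solved for the second
   one of [v]. *)
have e1 a b c : coef3 (Dirac k v).1 a b c =
    bracket k1 a.+1 * coef3 v.2 a.+1 b c - cauchy_step (fun s => coef3 (spin s v)) true a b c.
  by rewrite DiracE1 coef3_lin3 coef3_dunkl1 coef3_dunkl2 coef3_dunkl3 /cauchy_step expr1 /spin; ring.
have e2 a b c : coef3 (Dirac k v).2 a b c =
    bracket k1 a.+1 * coef3 v.1 a.+1 b c - cauchy_step (fun s => coef3 (spin s v)) false a b c.
  by rewrite DiracE2 coef3_lin3 coef3N coef3_dunkl1 coef3_dunkl2 coef3_dunkl3 /cauchy_step expr0 /spin; ring.
split=> [h [] a b c | h].
- by apply/eqP; rewrite -subr_eq0 -e1 h coef30.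
- by apply/eqP; rewrite -subr_eq0 -e2 h coef30.
by rewrite [LHS]surjective_pairing; congr (_, _); apply: coef3_inj => a b c;
  rewrite ?e1 ?e2 coef30; apply/eqP; rewrite subr_eq0 ?(h true) ?(h false).
Qed.

Lemma MnP n v : Mn k n v <->
  (forall s a b c, (a + b + c)%N != n -> coef3 (spin s v) a b c = 0) /\
  (forall s a b c,
    bracket k1 a.+1 * coef3 (spin s v) a.+1 b c = cauchy_step (fun s => coef3 (spin s v)) s a b c).
Proof.
split=> [[/homogeneousP h1 /homogeneousP h2 /Dirac_coef3 hD]|[h /Dirac_coef3 hD]].
  by split=> // -[].
by split=> //; apply/homogeneousP; [apply: (h false)|apply: (h true)].
Qed.

Lemma Mn_x3P n t v : Mn_x3 k n t v <->
  Mn k n v /\ forall s a b c, (c < t)%N -> coef3 (spin s v) a b c = 0.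
Proof.
have H (p : Pol) : (forall m : 'X_{1..3}, m \in msupp p -> (t <= m x3)%N) <->
    (forall a b c, (c < t)%N -> coef3 p a b c = 0).
  split=> h.
    move=> a b c hc; rewrite coef3E; apply: memN_msupp_eq0; apply: contraL hc => /h.
    by rewrite mnm3_3 -leqNgt.
  move=> m; rewrite mcoeff_msupp; apply: contraNT; rewrite -ltnNge => hm.
  by rewrite (mnm3E m) -coef3E; apply/eqP/h.
split=> [[hM [/H h1 /H h2]]|[hM h]]; first by split=> // -[].
by split=> //; split; apply/H; [apply: (h false)|apply: (h true)].
Qed.
End Coefficients.

(** * The operators [X], [Y], [Z] on the plane [x_1 = 0] *)

Section Operators.
Variable R : rcfType.
Local Notation C := (complex R).
Local Notation V := (V R).
Variables (k1 k2 k3 : R).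
Local Notation k := (kvec k1 k2 k3).

Definition coef3_opE := (coef3_X1, coef3_X2, coef3_X3, coef3_dunkl1, coef3_dunkl2, coef3_dunkl3,
  coef3_refl1, coef3_refl2, coef3_refl3).

Lemma cR_half : cR (1 / 2) = 1 / 2 :> C.
Proof. by rewrite cRM cR1 cRV cR_nat. Qed.

(** On the plane the term [x_1 T_3] drops out, and [D v = 0] replaces [T_1] by [T_2] and [T_3], so
    [Y v] is read off from the restriction of [v] alone. The same argument serves [Z]. *)
Lemma coef3_opY n v s b c : Mn k n v ->
  coef3 (spin s (opY k v)) 0 b c =
    ((-1) ^+ c * (bracket k3 c + 1 / 2 + cR k1) + cR k3) * coef3 (spin s v) 0 b c
    - (if c is c'.+1 then
         (-1) ^+ c * (@iC R * bracket k2 b.+1 * coef3 (spin (~~ s) v) 0 b.+1 c') else 0).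
Proof.
move=> /MnP[_ hD].
have h1 := hD false 0%N b c.-1; have h2 := hD true 0%N b c.-1.
move: h1 h2; rewrite /cauchy_step /spin expr0 expr1.
have i2 := iC2 R; rewrite -[c.-1]/(c.-1).
case: s; rewrite ?opYE1 ?opYE2 coef3_lin5 !coef3_opE; case: c => [|c] /= h1 h2;
  rewrite ?coef3_opE ?exprS ?expr0 cR_half.
- by rewrite {1}/bracket /=; ring.
- by ring: h1 i2.
- by rewrite {1}/bracket /=; ring.
- by ring: h2 i2.
Qed.

Lemma coef3_opZ n v s b c : Mn k n v ->
  coef3 (spin s (opZ k v)) 0 b c =
    ((-1) ^+ b * (bracket k2 b + 1 / 2 + cR k1) + cR k2) * coef3 (spin s v) 0 b c
    + (if b is b'.+1 then
         (-1) ^+ b * (@iC R * bracket k3 c.+1 * coef3 (spin (~~ s) v) 0 b' c.+1) else 0).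
Proof.
move=> /MnP[_ hD].
have h1 := hD false 0%N b.-1 c; have h2 := hD true 0%N b.-1 c.
move: h1 h2; rewrite /cauchy_step /spin expr0 expr1.
have i2 := iC2 R.
case: s; rewrite ?opZE1 ?opZE2 coef3_lin5 !coef3_opE; case: b => [|b] /= h1 h2;
  rewrite ?coef3_opE ?exprS ?expr0 cR_half.
- by rewrite {1}/bracket /=; ring.
- by ring: h2 i2.
- by rewrite {1}/bracket /=; ring.
- by ring: h1 i2.
Qed.

(** [X] involves only [x_2] and [x_3], so it commutes with restriction to the plane. *)
Lemma coef3_opX v s b c :
  coef3 (spin s (opX k v)) 0 b c =
    ((-1) ^+ (b + c) / 2 + cR k2 * (-1) ^+ c + cR k3 * (-1) ^+ b) * coef3 (spin s v) 0 b c
    + (-1) ^+ (b + c) * @iC R *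
      ((if c is c'.+1 then bracket k2 b.+1 * coef3 (spin (~~ s) v) 0 b.+1 c' else 0)
       - (if b is b'.+1 then bracket k3 c.+1 * coef3 (spin (~~ s) v) 0 b' c.+1 else 0)).
Proof.
case: s; rewrite /spin ?opXE1 ?opXE2 coef3_lin5 !coef3_opE; case: b => [|b]; case: c => [|c] /=;
  rewrite ?coef3_opE !exprD ?exprS ?expr0 cR_half; by field.
Qed.

(** Induction on the power of [x_1]. The power [x_3^m] never feeds into lower ones, either for
    degree reasons or through the factor [bracket k3 m]. The value [m = n + 1] gives injectivity on
    the submodule, [m = t_3] the kernel of the quotient map. *)
Lemma coef3_unique n m u w : Mn k n u -> Mn k n w ->
  (forall a, (a <= n)%N -> (0 < a)%N -> bracket k1 a != 0) ->
  (n < m)%N \/ bracket k3 m = 0 ->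
  (forall s b c, (c < m)%N -> (b + c)%N = n ->
     coef3 (spin s u) 0 b c = coef3 (spin s w) 0 b c) ->
  forall s a b c, (c < m)%N -> coef3 (spin s u) a b c = coef3 (spin s w) a b c.
Proof.
move=> /MnP[hu Du] /MnP[hw Dw] hbr hm h0 s a; elim: a s => [|a IH] s b c cm.
  have [e|ne] := eqVneq (b + c)%N n; first exact: h0.
  by rewrite hu ?hw.
have [an|na] := ltnP a n; last by rewrite hu ?hw //; apply/eqP; lia.
apply: (mulfI (hbr a.+1 an isT)); rewrite Du Dw /cauchy_step IH //.
congr (_ * (_ + _)); case: (ltnP c.+1 m) => hc; first by rewrite IH.
have -> : c.+1 = m by lia.
case: hm => [nm|->]; last by rewrite !mul0r.
by rewrite hu ?hw //; apply/eqP; lia.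
Qed.

(** * Extending data from the plane to an element of [M_n] *)

Section Extension.
Variables (n : nat) (f : bool -> nat -> nat -> C).
Hypothesis hbr : forall a, (a <= n)%N -> (0 < a)%N -> bracket k1 a != 0.
Hypothesis hf : forall s b c, (b + c)%N != n -> f s b c = 0.

(** A Cauchy-Kovalevskaya extension in [x_1]. [cauchy_step] keeps the exponent of [x_1], which
    [ext a'] already carries, hence the dummy argument [0]. *)
Fixpoint ext (a : nat) (s : bool) (b c : nat) : C :=
  if a is a'.+1 then cauchy_step k2 k3 (fun s _ => ext a' s) s 0 b c / bracket k1 a
  else f s b c.

Lemma ext_homogeneous a s b c : (a + b + c)%N != n -> ext a s b c = 0.
Proof.
elim: a s b c => [|a IH] s b c h /=; first exact: hf.
by rewrite /cauchy_step !IH ?mulr0 ?addr0 ?mulr0 ?mul0r //; apply: contraNneq h => <-; apply/eqP; lia.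
Qed.

(** Only [x_3^t] could contribute to [x_3^(t-1)], and it does so with the factor
    [bracket k3 t = 0]. *)
Lemma ext_support t : bracket k3 t = 0 -> (forall s b c, (c < t)%N -> f s b c = 0) ->
  forall a s b c, (c < t)%N -> ext a s b c = 0.
Proof.
move=> ht h a; elim: a => [|a IH] s b c hc /=; first exact: h.
rewrite /cauchy_step IH // mulr0 add0r; case: (ltnP c.+1 t) => hc'.
  by rewrite IH // !mulr0 mul0r.
have -> : c.+1 = t by lia.
by rewrite ht !mul0r mulr0 mul0r.
Qed.

Definition ext_spinor : V :=
  (\sum_(m : 'X_{1..3 < n.+1}) ext (m x1) false (m x2) (m x3) *: 'X_[m],
   \sum_(m : 'X_{1..3 < n.+1}) ext (m x1) true (m x2) (m x3) *: 'X_[m]).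

Lemma coef3_ext_spinor s a b c : coef3 (spin s ext_spinor) a b c = ext a s b c.
Proof.
have H s' : coef3 (\sum_(m : 'X_{1..3 < n.+1}) ext (m x1) s' (m x2) (m x3) *: 'X_[m]) a b c
    = ext a s' b c.
  have [h|h] := leqP (a + b + c) n.
    rewrite coef3E (mcoeff_mpoly (fun m => ext (m x1) s' (m x2) (m x3))) ?mnm3_1 ?mnm3_2 ?mnm3_3 //.
    by rewrite mdeg_mnm3.
  rewrite ext_homogeneous; last by rewrite gtn_eqF.
  rewrite coef3E raddf_sum big1 //= => m _; rewrite mcoeffZ mcoeffX.
  case: eqP => [e|]; last by rewrite mulr0.
  by have := bmdeg m; rewrite e mdeg_mnm3; lia.
by case: s; rewrite /spin /= H.
Qed.

Lemma ext_spinor_Mn : Mn k n ext_spinor.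
Proof.
apply/MnP; split=> s a b c; rewrite !coef3_ext_spinor; first exact: ext_homogeneous.
rewrite /cauchy_step !coef3_ext_spinor.
have [an|na] := ltnP a n; first by rewrite /= mulrC divfK ?hbr.
(* For [a >= n], where the divisor [bracket k1 a.+1] may vanish, all coefficients involved are zero
   by degree. *)
rewrite !ext_homogeneous ?mulr0 ?addr0 ?mulr0 //; apply/eqP; lia.
Qed.
End Extension.
End Operators.

(** * The restriction map *)

Section Columns.
Variable R : rcfType.
Local Notation C := (complex R).
Variables (d : nat) (a b c : C).
Hypothesis ed : ~~ odd d.
Local Notation pre f i := (if i is i'.+1 then f i' else 0).
Local Notation colf f := (\col_(i < d.+1) f (val i)).

Lemma OX_col (f : nat -> C) :
  OX d a b c *m colf f = colf (fun i => Otheta a d i * f i + pre f i).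
Proof.
apply/colP => i; rewrite !mxE; case: i => i hi /=.
rewrite (bigD1 (Ordinal hi)) //= !mxE eqxx; congr (_ + _).
case: i hi => [|i] hi; rewrite /=.
  rewrite big1 // => j hj; rewrite !mxE /=.
  case: eqP => [e|_]; first by case/eqP: hj; apply/val_inj.
  by rewrite mul0r.
rewrite (bigD1 (Ordinal (ltnW hi))) /=; last by rewrite -val_eqE /= ltn_eqF.
rewrite !mxE /= eqxx gtn_eqF // mul1r big1 ?addr0 // => j /andP[h1 h2]; rewrite !mxE /=.
case: eqP => [e|_]; first by case/eqP: h1; apply/val_inj.
case: eqP => [[e]|_]; first by case/eqP: h2; apply/val_inj.
by rewrite mul0r.
Qed.

(** Lets [OY_col] and [OZ_col] treat the last row like the others, whatever [f d.+1] is. *)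
Lemma Ophi_last : Ophi a b c d d.+1 = 0.
Proof.
have e0 : d.+1%:R - d%:R - 1 = 0 :> C by rewrite -natr1; ring.
by rewrite /Ophi /= ed /= e0 !mul0r.
Qed.

Lemma OY_col (f : nat -> C) :
  OY d a b c *m colf f = colf (fun i => Otheta b d i * f i + Ophi a b c d i.+1 * f i.+1).
Proof.
apply/colP => i; rewrite !mxE; case: i => i hi /=.
rewrite (bigD1 (Ordinal hi)) //= !mxE eqxx; congr (_ + _).
case: (ltnP i d) => h.
  have h' : (i.+1 < d.+1)%N by [].
  rewrite (bigD1 (Ordinal h')) /=; last by rewrite -val_eqE /= gtn_eqF.
  rewrite !mxE /= eqxx ltn_eqF // big1 ?addr0 // => j /andP[h1 h2]; rewrite !mxE /=.
  case: eqP => [e|_]; first by case/eqP: h1; apply/val_inj.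
  case: eqP => [e|_]; first by case/eqP: h2; apply/val_inj.
  by rewrite mul0r.
have id : i = d by lia.
rewrite [in RHS]id Ophi_last mul0r big1 // => j h1; rewrite !mxE /=.
case: eqP => [e|_]; first by case/eqP: h1; apply/val_inj => /=; lia.
case: eqP => [e|_]; last by rewrite mul0r.
by have := ltn_ord j; lia.
Qed.

Definition Ozeta i : C := 2 * Otheta a d i * Otheta b d i + Ophi a b c d i
  + Ophi a b c d i.+1 - (2 * a * b - c * d.+1%:R).

Lemma OZ_col (f : nat -> C) : OZ d a b c *m colf f =
  colf (fun i => Ozeta i * f i + (-1) ^+ i * pre f i - (-1) ^+ i * Ophi a b c d i.+1 * f i.+1).
Proof.
rewrite OZ_def mulmxBl mulmxDl -!mulmxA (OX_col f) (OY_col f) mul_scalar_mx.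
rewrite (OX_col (fun i => Otheta b d i * f i + Ophi a b c d i.+1 * f i.+1)).
rewrite (OY_col (fun i => Otheta a d i * f i + pre f i)).
apply/colP => i; rewrite !mxE /Ozeta; case: i => -[|i] hi /=.
  by rewrite /Otheta /Ophi /= expr0 expr1; field.
rewrite /Otheta !exprS; move: (Ophi _ _ _ _ i.+1) (Ophi _ _ _ _ i.+2) => p q.
by case: (signP R i) => -[-> _]; field.
Qed.
End Columns.

(** * Restriction to the plane intertwines the actions *)

Section Restriction.
Variable R : rcfType.
Local Notation C := (complex R).
Local Notation V := (V R).
Variables (k1 k2 k3 : R).
Local Notation k := (kvec k1 k2 k3).
Variables n o d : nat.

(* The rescaling that turns the subdiagonal entries of [Y] into [(-1)^o]. *)
Fixpoint rescale i : C :=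
  if i is i'.+1 then (-1) ^+ i' * rescale i' / (@iC R * bracket k2 (n - (o + i'))) else 1.

(* The submodule and the quotient correspond to the powers [x_3^(o+i)], [i <= d], with
   [o = t_3] and [o = 0] respectively; [eps] selects one of the two copies. *)
Definition bdcoef (eps : bool) (v : V) i : C :=
  coef3 (spin (eps (+) odd (o + i)) v) 0 (n - (o + i)) (o + i).

Definition restr (v : V) : 'cV[C]_d.+1 * 'cV[C]_d.+1 :=
  (\col_(i < d.+1) (rescale i * bdcoef false v i), \col_(i < d.+1) (rescale i * bdcoef true v i)).

Hypothesis hbr2 : forall j, (j <= n)%N -> (0 < j)%N -> bracket k2 j != 0.

Lemma iC_neq0 : @iC R != 0.
Proof. by apply/eqP => h; have := iC2 R; rewrite h mul0r => /esym/eqP; rewrite oppr_eq0 oner_eq0. Qed.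

Lemma rescaleS i : (o + i < n)%N ->
  rescale i.+1 * (@iC R * bracket k2 (n - (o + i))) = (-1) ^+ i * rescale i.
Proof. by move=> h; rewrite /= divfK // mulf_neq0 ?iC_neq0 // hbr2 //; lia. Qed.

Hypothesis odn : (o + d <= n)%N.

Lemma rescale_neq0 i : (i <= d)%N -> rescale i != 0.
Proof.
elim: i => [|i IH] hi; first exact: oner_neq0.
have h : (o + i < n)%N by lia.
apply/eqP => h0; have := rescaleS h; rewrite h0 mul0r => /esym/eqP.
by rewrite mulf_eq0 signr_eq0 /=; apply/negP/IH; lia.
Qed.

Variables a b c : C.
Hypotheses (on : odd n) (ed : ~~ odd d).
Hypothesis hth : forall i, (i <= d)%N -> Otheta a d i =
  (-1) ^+ o * ((-1) ^+ (o + i) * (bracket k3 (o + i) + 1 / 2 + cR k1) + cR k3).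
Hypothesis hths : forall i, (i <= d)%N -> Otheta b d i =
  (-1) ^+ o * ((-1) ^+ (n - (o + i)) * (bracket k2 (n - (o + i)) + 1 / 2 + cR k1) + cR k2).
Hypothesis hph : forall i, (i <= d)%N ->
  Ophi a b c d i.+1 = bracket k2 (n - (o + i)) * bracket k3 (o + i).+1.
Hypothesis hze : forall i, (i <= d)%N -> Ozeta d a b c i =
  - 1 / 2 + cR k2 * (-1) ^+ (o + i) + cR k3 * (-1) ^+ (n - (o + i)).

Lemma sign_sqr m : (-1) ^+ m * (-1) ^+ m = 1 :> C.
Proof. by rewrite -expr2 sqrr_sign. Qed.

Lemma sign_subn i : (i <= n)%N -> (-1) ^+ (n - i) = - (-1) ^+ i :> C.
Proof.
move=> h; rewrite -signr_odd oddB // on -[in RHS]signr_odd.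
by case: (odd i); rewrite /= ?expr0 ?expr1 ?opprK.
Qed.

Section Intertwine.
Variable v : V.
Hypothesis hv : Mn k n v.
Hypothesis hv0 : forall s b c, (c < o)%N -> coef3 (spin s v) 0 b c = 0.

(** The sign [(-1) ^+ o] is that of the twist: [-1] for the submodule, where [o = t_3] is odd, and
    [1] for the quotient, where [o = 0]. *)
Lemma bdcoef_opY eps : \col_(i < d.+1) (rescale i * bdcoef eps (opY k v) i) =
  (-1) ^+ o *: (OX d a b c *m \col_(i < d.+1) (rescale i * bdcoef eps v i)).
Proof.
rewrite (OX_col _ _ _ _ (fun i => rescale i * bdcoef eps v i)).
apply/colP => i; rewrite !mxE; case: i => i hi /=.
rewrite {1}/bdcoef (coef3_opY _ _ _ hv) hth //.
case: i hi => [|i] hi.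
  rewrite addn0 addr0; set y := _ * _ + cR k3.
  (* For [i = 0] the lower neighbour is [x_3^(o-1)], which is absent or has zero coefficient by
     [hv0]. *)
  have -> : (if o is c'.+1 then (-1) ^+ o *
    (@iC R * bracket k2 (n - o).+1 * coef3 (spin (~~ (eps (+) odd o)) v) 0 (n - o).+1 c') else 0) = 0.
    by move: hv0; case: (o) => // o' h; rewrite h // !mulr0.
  rewrite /= mul1r subr0 mul1r mulrA [_ * (_ * y)]mulrA sign_sqr mul1r /bdcoef addn0; ring.
have h : (o + i < n)%N by lia.
have -> : (n - (o + i.+1)).+1 = (n - (o + i))%N by lia.
have -> : ~~ (eps (+) odd (o + i.+1)) = eps (+) odd (o + i).
  by rewrite addnS /= addbN negbK.
have -> : (o + i.+1)%N = (o + i).+1 by rewrite addnS.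
rewrite -/(bdcoef eps v i) -[coef3 _ 0 _ (o + i).+1]/(coef3 _ 0 _ _).
have e1 := rescaleS h; have e2 := sign_sqr o.
set w := coef3 _ _ _ (o + i).+1.
have -> : bdcoef eps v i.+1 = w by rewrite /bdcoef /w addnS.
move: e1; set L := rescale i.+1; move: (bracket k2 (n - (o + i))) => B e1.
rewrite exprS exprD; have e3 := sign_sqr i.
transitivity (L * ((-1 * ((-1) ^+ o * (-1) ^+ i) * (bracket k3 (o + i).+1 + 1 / 2 + cR k1) + cR k3) * w) +
  (-1) ^+ o * (-1) ^+ i * bdcoef eps v i * (L * (@iC R * B))); first by ring.
rewrite e1; move: ((-1) ^+ o) e2 ((-1) ^+ i) e3 => eo e2 ei e3.
by ring: e2 e3.
Qed.

Lemma bdcoef_opZ eps : \col_(i < d.+1) (rescale i * bdcoef eps (opZ k v) i) =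
  (-1) ^+ o *: (OY d a b c *m \col_(i < d.+1) (rescale i * bdcoef eps v i)).
Proof.
rewrite (OY_col _ _ _ ed (fun i => rescale i * bdcoef eps v i)).
apply/colP => i; rewrite !mxE; case: i => i hi /=.
rewrite -/(rescale i.+1) {1}/bdcoef (coef3_opZ _ _ _ hv) hths // hph // -/(bdcoef eps v i).
have e2 := sign_sqr o; have e3 := sign_sqr i.
(* At the top power [x_3^n] there is no upper neighbour, in agreement with [bracket k2 0 = 0]. *)
case: (ltnP (o + i) n) => h; last first.
  have -> : (n - (o + i))%N = 0%N by lia.
  by rewrite /bracket /=; ring: e2.
have hb : (n - (o + i))%N = (n - (o + i.+1)).+1 by lia.
have e1 := rescaleS h.
rewrite (sign_subn (ltnW h)) {2}hb.
have -> : ~~ (eps (+) odd (o + i)) = eps (+) odd (o + i.+1).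
  by rewrite addnS /= addbN.
have -> : (o + i).+1 = (o + i.+1)%N by rewrite addnS.
rewrite -/(bdcoef eps v i.+1) exprD.
move: e1 e2 e3; move: (rescale i.+1) (rescale i) (bracket k2 _) (bracket k3 _) (bdcoef _ _ i.+1) (bdcoef _ _ i)
  ((-1) ^+ o) ((-1) ^+ i) => L l B B3 w1 w0 eo ei e1 e2 e3.
(* Eliminating [l] instead of [L] avoids the division in [rescale] and leaves a polynomial
   identity. *)
have el : l = ei * (L * (@iC R * B)) by rewrite e1 mulrA e3 mul1r.
rewrite el; have i2 := iC2 R; by ring: e2 e3 i2.
Qed.

Lemma bdcoef_opX eps : \col_(i < d.+1) (rescale i * bdcoef eps (opX k v) i) =
  OZ d a b c *m \col_(i < d.+1) (rescale i * bdcoef eps v i).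
Proof.
rewrite (OZ_col _ _ _ ed (fun i => rescale i * bdcoef eps v i)).
apply/colP => i; rewrite !mxE; case: i => i hi /=.
rewrite -/(rescale i.+1) {1}/bdcoef coef3_opX hze // hph // -/(bdcoef eps v i).
have oin : (o + i <= n)%N by lia.
have i2 := iC2 R; have e3 := sign_sqr i.
rewrite subnK // (_ : (-1) ^+ n = -1); last by rewrite -signr_odd on.
(* The contributions of the neighbours [x_3^(o+i-1)] and [x_3^(o+i+1)]. *)
set low := (if (o + i)%N is c'.+1 then _ else 0).
set high := (if (n - (o + i))%N is c'.+1 then _ else 0).
have e_low : rescale i * (@iC R * low) = - (-1) ^+ i * (if i is i'.+1 then rescale i' * bdcoef eps v i' else 0).
  rewrite /low; case: i hi oin {low high e3} => [|i] hi oin.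
    rewrite addn0 mulr0; move: hv0; case: (o) => [|o'] h; rewrite ?mulr0 //.
    by rewrite h // !mulr0.
  have h : (o + i < n)%N by lia.
  have -> : (n - (o + i.+1)).+1 = (n - (o + i))%N by lia.
  have -> : ~~ (eps (+) odd (o + i.+1)) = eps (+) odd (o + i).
    by rewrite addnS /= addbN negbK.
  rewrite addnS -/(bdcoef eps v i) exprS.
  by transitivity (rescale i.+1 * (@iC R * bracket k2 (n - (o + i))) * bdcoef eps v i);
    [ring | rewrite rescaleS //; ring].
have e_high : rescale i * (@iC R * high) =
    - (-1) ^+ i * (bracket k2 (n - (o + i)) * bracket k3 (o + i).+1) * (rescale i.+1 * bdcoef eps v i.+1).
  rewrite /high; case: (ltnP (o + i) n) => h; last first.
    have -> : (n - (o + i))%N = 0%N by lia.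
    by rewrite /bracket /=; ring.
  have hb : (n - (o + i))%N = (n - (o + i.+1)).+1 by lia.
  have e1 := rescaleS h.
  rewrite {1}hb.
  have -> : ~~ (eps (+) odd (o + i)) = eps (+) odd (o + i.+1).
    by rewrite addnS /= addbN.
  have -> : (o + i).+1 = (o + i.+1)%N by rewrite addnS.
  rewrite -/(bdcoef eps v i.+1).
  move: e1; move: (rescale i.+1) (rescale i) (bracket k2 _) (bracket k3 _) (bdcoef _ _ i.+1)
    ((-1) ^+ i) e3 => L l B B3 w1 ei e3 e1.
  have el : l = ei * (L * (@iC R * B)) by rewrite e1 mulrA e3 mul1r.
  by rewrite el; ring: i2.
rewrite sign_subn //.
transitivity (rescale i * ((-1 / 2 + cR k2 * (-1) ^+ (o + i) + cR k3 * - (-1) ^+ (o + i)) * bdcoef eps v i)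
  - rescale i * (@iC R * low) + rescale i * (@iC R * high)); first by ring.
by rewrite e_low e_high; case: (i) => [|?]; ring.
Qed.
End Intertwine.
End Restriction.

(** * Linearity, injectivity on the plane and surjectivity of the restriction *)

Section Bijection.
Variable R : rcfType.
Local Notation C := (complex R).
Variables (k1 k2 k3 : R).
Local Notation k := (kvec k1 k2 k3).
Variables (n o d : nat).
Hypothesis odn : (o + d <= n)%N.
Hypothesis hbr1 : forall j, (j <= n)%N -> (0 < j)%N -> bracket k1 j != 0.
Hypothesis hbr2 : forall j, (j <= n)%N -> (0 < j)%N -> bracket k2 j != 0.
Hypothesis hbr3 : bracket k3 o = 0.
Local Notation phi := (restr k2 n o d).

Lemma restr_linear (S : V R -> Prop) : linear_on S phi.
Proof.
move=> s u w _ _; congr (_, _); apply/colP => i; rewrite !mxE /bdcoef /=.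
  by case: (odd _); rewrite /spin /addV /scaleV /= coef3D coef3Z; ring.
by case: (odd _); rewrite /spin /addV /scaleV /= coef3D coef3Z; ring.
Qed.

Lemma restr_eq u w : phi u = phi w -> forall s c, (o <= c <= o + d)%N ->
  coef3 (spin s u) 0 (n - c) c = coef3 (spin s w) 0 (n - c) c.
Proof.
move=> [/colP h1 /colP h2] s c /andP[oc cd].
have hc : (c - o < d.+1)%N by lia.
have := h1 (Ordinal hc); have := h2 (Ordinal hc); rewrite !mxE /bdcoef /= subnKC //.
have l0 : rescale k2 n o (c - o) != 0 by apply: (rescale_neq0 hbr2 odn); lia.
move=> /(mulfI l0) e2 /(mulfI l0) e1.
by move: e1 e2; case: s; case: (odd c).
Qed.

(** The prescribed columns, divided by [rescale], are placed on [x_3^o, ..., x_3^(o+d)] in the plane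
    and extended by [ext_spinor]; [hbr3] keeps lower powers of [x_3] absent. *)
Lemma restr_surj (y : 'cV[C]_d.+1 * 'cV[C]_d.+1) : exists u,
  [/\ Mn k n u, forall s a b c, (c < o)%N -> coef3 (spin s u) a b c = 0 & phi u = y].
Proof.
(* Component [s] at [x_3^c] belongs to the copy selected by [s (+) odd c]. *)
pose f (s : bool) b c : C := if [&& (b + c == n)%N, (o <= c)%N & (c <= o + d)%N]
  then (if s (+) odd c then y.2 else y.1) (inord (c - o)) 0 / rescale k2 n o (c - o) else 0.
have hf s b c : (b + c)%N != n -> f s b c = 0 by move=> /negbTE h; rewrite /f h.
exists (ext_spinor k1 k2 k3 n f); split.
- exact: ext_spinor_Mn.
- move=> s a b c hc; rewrite coef3_ext_spinor //; apply: (ext_support k1 k2 hbr3) => // s' b' c' hc'.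
  by rewrite /f [(o <= c')%N]leqNgt hc' /= andbF.
have E s i : (i <= d)%N -> rescale k2 n o i * bdcoef n o s (ext_spinor k1 k2 k3 n f) i =
    (if s then y.2 else y.1) (inord i) 0.
  move=> hi; rewrite /bdcoef coef3_ext_spinor //= /f subnK; last by lia.
  rewrite eqxx leq_addr leq_add2l hi /= addKn addbK mulrC divfK //.
  exact: (rescale_neq0 hbr2 odn).
rewrite [RHS]surjective_pairing; congr (_, _); apply/colP => i; rewrite mxE E ?inord_val //.
  by have := ltn_ord i; lia.
by have := ltn_ord i; lia.
Qed.
End Bijection.

(** * The two isomorphisms and the theorem *)

Section Main.
Variable R : rcfType.
Local Notation C := (complex R).

(** The hypothesis says [n < t_i], with [t_i] infinite when no such [m] exists; a zero of
    [bracket x] at [j > 0] forces [j] odd and [2 x = - j]. *)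
Lemma bracket_neq0 (x : R) n : (forall m : nat, odd m -> 2 * x = - (m%:R) -> (n < m)%N) ->
  forall j, (j <= n)%N -> (0 < j)%N -> bracket x j != 0.
Proof.
move=> h j jn j0; have -> : bracket x j = cR (j%:R + (if odd j then 2 * x else 0)).
  by rewrite /bracket cRD cR_nat; case: (odd j); rewrite ?cRM ?cR_nat.
rewrite -cR0 (inj_eq (@cR_inj R)); case: (boolP (odd j)) => oj; last first.
  by rewrite addr0 pnatr_eq0 -lt0n.
apply/eqP => e; have := h j oj; rewrite ltnNge jn => hh.
by have : false by apply: hh; apply/eqP; rewrite -addr_eq0 addrC e.
Qed.

Lemma Mn0 (k1 k2 k3 : R) n : Mn (kvec k1 k2 k3) n (0, 0).
Proof.
have z s : spin s (0, 0) = 0 :> Pol R by case: s.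
apply/MnP; split=> s a b c; rewrite ?z ?coef30 //.
by rewrite /cauchy_step !z !coef30 !mulr0 addr0 mulr0.
Qed.

Variables (k1 k2 k3 : R) (n t : nat).
Local Notation k := (kvec k1 k2 k3).
Hypotheses (ot : odd t) (k3t : 2 * k3 = - t%:R) (on : odd n) (tn : (t <= n)%N).
Hypothesis hbr1 : forall j, (j <= n)%N -> (0 < j)%N -> bracket k1 j != 0.
Hypothesis hbr2 : forall j, (j <= n)%N -> (0 < j)%N -> bracket k2 j != 0.
Local Notation K := (cR (k1 + k2 + k3)).
Local Notation h := ((n.+1)%:R / 2 : C).

Lemma k3E : cR k3 = - t%:R / 2.
Proof.
have -> : k3 = - t%:R / 2 by rewrite -k3t; field.
by rewrite cRM cRN cRV !cR_nat.
Qed.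

Lemma bracket_t : bracket k3 t = 0.
Proof. by rewrite /bracket ot k3E; field. Qed.

Lemma sub_iso : iso_to_double k (Mn_x3 k n t)
  (twistmm132 (Omod (n - t) (cR k1 + h) (- K - h) (- cR k2 - h))).
Proof.
have ed : ~~ odd (n - t) by rewrite oddB // ot on.
have odn : (t + (n - t) <= n)%N by rewrite subnKC.
have dE : (n - t)%:R = n%:R - t%:R :> C by rewrite natrB.
have dE1 : (n - t).+1%:R = n%:R - t%:R + 1 :> C by rewrite -natr1 dE.
have hth i : (i <= n - t)%N -> Otheta (cR k1 + h) (n - t) i =
    (-1) ^+ t * ((-1) ^+ (t + i) * (bracket k3 (t + i) + 1 / 2 + cR k1) + cR k3).
  move=> hi; rewrite exprD -(signr_odd _ t) ot expr1 /Otheta /bracket oddD ot dE k3E natrD -natr1.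
  by case: (signP R i) => -[-> ->] /=; field.
have hths i : (i <= n - t)%N -> Otheta (- K - h) (n - t) i =
    (-1) ^+ t * ((-1) ^+ (n - (t + i)) * (bracket k2 (n - (t + i)) + 1 / 2 + cR k1) + cR k2).
  move=> hi; have hi' : (t + i <= n)%N by lia.
  rewrite (sign_subn R on) // exprD -(signr_odd _ t) ot expr1 /Otheta /bracket oddB // oddD ot on dE.
  rewrite !cRD k3E natrB // natrD -natr1.
  by case: (signP R i) => -[-> ->] /=; field.
(* At [i = n - t] both sides vanish, the right one through [bracket k2 0]. *)
have hph i : (i <= n - t)%N -> Ophi (cR k1 + h) (- K - h) (- cR k2 - h) (n - t) i.+1 =
    bracket k2 (n - (t + i)) * bracket k3 (t + i).+1.
  move=> hi; have hi' : (t + i <= n)%N by lia.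
  rewrite /Ophi /bracket oddB // /= !oddD ot on dE.
  rewrite !cRD k3E natrB // -!natr1 !natrD.
  by case: (odd i) => /=; field.
have hze i : (i <= n - t)%N -> Ozeta (n - t) (cR k1 + h) (- K - h) (- cR k2 - h) i =
    - 1 / 2 + cR k2 * (-1) ^+ (t + i) + cR k3 * (-1) ^+ (n - (t + i)).
  move=> hi; have hi' : (t + i <= n)%N by lia.
  rewrite (sign_subn R on) // exprD -(signr_odd _ t) ot expr1 /Ozeta hph // /Otheta.
  case: i hi hi' => [|i] hi hi'; last rewrite hph ?(ltnW hi) //.
    rewrite {1}/Ophi /= !mul0r addr0 /bracket oddB // /= !oddD ot on dE dE1 !cRD k3E natrB // -!natr1 !natrD.
    by rewrite expr0 /=; field.
  have hi2 : (t + i <= n)%N by lia.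
  rewrite /bracket !oddB // /= !oddD /= ot on dE1 dE !cRD k3E !natrB // -!natr1 !natrD -!natr1.
  rewrite exprS; by case: (signP R i) => -[-> ->] /=; field.
have bt := bracket_t.
have supp u : Mn_x3 k n t u -> forall s b c, (c < t)%N -> coef3 (spin s u) 0 b c = 0.
  by move=> /Mn_x3P[_ hu] s b c; apply: hu.
exists (restr k2 n t (n - t)); split.
- exact: restr_linear.
- move=> u Su; have uM : Mn k n u by case: Su.
  have hu := supp u Su.
  rewrite /actX /actY /actZ /dsum_act /= !mulNmx; split; congr (_, _).
  + exact: bdcoef_opX.
  + exact: bdcoef_opX.
  + rewrite -scaleN1r -[-1](_ : (-1) ^+ t = _); last by rewrite -signr_odd ot.
    exact: bdcoef_opY.
  + rewrite -scaleN1r -[-1](_ : (-1) ^+ t = _); last by rewrite -signr_odd ot.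
    exact: bdcoef_opY.
  + rewrite -scaleN1r -[-1](_ : (-1) ^+ t = _); last by rewrite -signr_odd ot.
    exact: bdcoef_opZ.
  + rewrite -scaleN1r -[-1](_ : (-1) ^+ t = _); last by rewrite -signr_odd ot.
    exact: bdcoef_opZ.
- move=> u w Su Sw /(restr_eq odn hbr2) huw.
  have uM : Mn k n u by case: Su.
  have wM : Mn k n w by case: Sw.
  (* Powers above [x_3^n] vanish by degree. For the others, agreement on the plane comes from [supp]
     below [x_3^t] and from [huw] otherwise, and [coef3_unique] propagates it. *)
  have all_eq s a b c : coef3 (spin s u) a b c = coef3 (spin s w) a b c.
    case: (ltnP c n.+1) => hc; last first.
      move/MnP: uM => [hu _]; move/MnP: wM => [hw _].
      by rewrite hu ?hw //; apply/eqP; lia.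
    apply: (coef3_unique uM wM hbr1 (or_introl (ltnSn n))) hc => s' b' c' _ e.
    case: (ltnP c' t) => hct; first by rewrite !supp.
    have -> : b' = (n - c')%N by lia.
    by apply: huw; lia.
  rewrite [u]surjective_pairing [w]surjective_pairing.
  by congr (_, _); apply: coef3_inj => a b c; [apply: (all_eq false)|apply: (all_eq true)].
- move=> y; have [u [uM us uy]] := restr_surj odn hbr1 hbr2 bt y.
  by exists u => //; apply/Mn_x3P.
Qed.

Lemma quot_iso : quot_iso_to_double k (Mn k n) (Mn_x3 k n t)
  (twist132 (Omod t.-1 (cR k1) (- K - n.+1%:R) (cR k2))).
Proof.
have t0 : (0 < t)%N by case: (t) ot.
have ed : ~~ odd t.-1 by case: (t) ot.
have odn : (0 + t.-1 <= n)%N by lia.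
have dE : t.-1%:R = t%:R - 1 :> C by rewrite -[in RHS](prednK t0) -natr1 addrK.
have hth i : (i <= t.-1)%N -> Otheta (cR k1) t.-1 i =
    (-1) ^+ 0 * ((-1) ^+ (0 + i) * (bracket k3 (0 + i) + 1 / 2 + cR k1) + cR k3).
  move=> hi; rewrite expr0 add0n /Otheta /bracket dE k3E.
  by case: (signP R i) => -[-> ->] /=; field.
have hths i : (i <= t.-1)%N -> Otheta (- K - n.+1%:R) t.-1 i =
    (-1) ^+ 0 * ((-1) ^+ (n - (0 + i)) * (bracket k2 (n - (0 + i)) + 1 / 2 + cR k1) + cR k2).
  move=> hi; have hi' : (i <= n)%N by lia.
  rewrite add0n (sign_subn R on) // expr0 /Otheta /bracket oddB // on dE !cRD k3E natrB // -natr1.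
  by case: (signP R i) => -[-> ->] /=; field.
(* At [i = t - 1] both sides vanish, now through [bracket k3 t]: this is where the quotient ends. *)
have hph i : (i <= t.-1)%N -> Ophi (cR k1) (- K - n.+1%:R) (cR k2) t.-1 i.+1 =
    bracket k2 (n - (0 + i)) * bracket k3 (0 + i).+1.
  move=> hi; have hi' : (i <= n)%N by lia.
  rewrite add0n /Ophi /bracket oddB // /= on dE !cRD k3E natrB // -!natr1.
  by case: (odd i) => /=; field.
have hze i : (i <= t.-1)%N -> Ozeta t.-1 (cR k1) (- K - n.+1%:R) (cR k2) i =
    - 1 / 2 + cR k2 * (-1) ^+ (0 + i) + cR k3 * (-1) ^+ (n - (0 + i)).
  move=> hi; have hi' : (i <= n)%N by lia.
  rewrite add0n (sign_subn R on) // /Ozeta hph // add0n /Otheta prednK //.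
  case: i hi hi' => [|i] hi hi'; last rewrite hph ?(ltnW hi) // add0n.
    rewrite {1}/Ophi /= !mul0r addr0 /bracket subn0 /= on dE !cRD k3E -!natr1.
    by rewrite expr0 /=; field.
  have hi2 : (i <= n)%N by lia.
  rewrite /bracket !oddB // /= on dE !cRD k3E !natrB // -!natr1.
  rewrite exprS; by case: (signP R i) => -[-> ->] /=; field.
have b0 : bracket k3 0 = 0 by rewrite /bracket /= addr0.
exists (restr k2 n 0 t.-1); split.
- exact: restr_linear.
- move=> u uM; rewrite /actX /actY /actZ /dsum_act /=; split; congr (_, _).
  + exact: bdcoef_opX.
  + exact: bdcoef_opX.
  + by rewrite -[RHS]scale1r -(expr0 (-1)); apply: bdcoef_opY.
  + by rewrite -[RHS]scale1r -(expr0 (-1)); apply: bdcoef_opY.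
  + by rewrite -[RHS]scale1r -(expr0 (-1)); apply: bdcoef_opZ.
  + by rewrite -[RHS]scale1r -(expr0 (-1)); apply: bdcoef_opZ.
- move=> u uM; split=> [phi0 | /Mn_x3P[_ hu]].
    apply/Mn_x3P; split=> // s a b c hc.
    (* Comparison with the zero spinor for powers below [x_3^t]; [bracket k3 t = 0] shields them
       from the higher ones, on which nothing is known. *)
    have wM : Mn k n (0, 0) by exact: Mn0.
    have phiw : restr k2 n 0 t.-1 (0, 0) = (0, 0).
      by congr (_, _); apply/colP => i; rewrite !mxE /bdcoef; case: (odd _); rewrite /spin /= coef30 mulr0.
    have := restr_eq odn hbr2 (etrans phi0 (esym phiw)) => huw.
    rewrite (coef3_unique uM wM hbr1 (or_intror bracket_t)) //; first by case: s; rewrite /spin /= coef30.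
    move=> s' b' c' hc' e; have -> : b' = (n - c')%N by lia.
    by apply: huw; lia.
  congr (_, _); apply/colP => i; rewrite !mxE /bdcoef hu ?mulr0 //; have := ltn_ord i; lia.
- by move=> y; have [u [uM _ uy]] := restr_surj odn hbr1 hbr2 b0 y; exists u.
Qed.
End Main.

Theorem theorem7p3 (R : rcfType) (k1 k2 k3 : R) (n t3 : nat) :
  (* t_3 = -2 k_3 is finite (2 k_3 is an odd negative integer) *)
  odd t3 -> 2 * k3 = - (t3%:R) ->
  (* n odd with t_3 <= n < min(t_1, t_2) *)
  odd n -> (t3 <= n)%N ->
  (forall m : nat, odd m -> 2 * k1 = - (m%:R) -> (n < m)%N) ->
  (forall m : nat, odd m -> 2 * k2 = - (m%:R) -> (n < m)%N) ->
  let k := kvec k1 k2 k3 in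
  let K := cR (k1 + k2 + k3) in
  let h := (n.+1)%:R / 2 : complex R in
  let W1 := twistmm132 (Omod (n - t3) (cR k1 + h) (- K - h) (- cR k2 - h)) in
  let W2 := twist132 (Omod t3.-1 (cR k1) (- K - n.+1%:R) (cR k2)) in
  [/\ iso_to_double k (Mn_x3 k n t3) W1,
      quot_iso_to_double k (Mn k n) (Mn_x3 k n t3) W2
    & (0 <= k1 -> 0 <= k2 ->
       [/\ mat_irreducible W1, mat_irreducible W2,
           mat_iso W1 (Omod (n - t3) (- cR k2 - h) (- cR k1 - h) (K + h))
         & mat_iso W2 (Omod t3.-1 (cR k2) (cR k1) (- K - n.+1%:R))])].
Proof.
move=> ot k3t on tn /bracket_neq0 hbr1 /bracket_neq0 hbr2 k K h W1 W2; split.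
- exact: sub_iso.
- exact: quot_iso.
move=> k1_ge0 k2_ge0; split.
- by apply: irreducible_twistmm132; rewrite /h half_cR; apply: W1_irreducible.
- by apply: irreducible_twist132; apply: W2_irreducible.
- by rewrite /W1 /h half_cR; apply: W1_iso.
- exact: W2_iso.
Qed.
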